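(* Let $n \ge 2$ be an integer. Then the following set of polynomials is a basis for the complex vector space $\mathscr{P}_{n,2}$: $$x^{(r_1)}(t_0)\,x^{(r_2)}(t_0), \qquad x^{(k_1)}(t_0)\,x^{(k_2)}(t_0)-\frac{k_1}{k_2+1}\,x^{(k_1-1)}(t_0)\,x^{(k_2+1)}(t_0),$$ where the integers $r_1,r_2$ range over $0 \le r_2 \le r_1\le n-2-r_2$ and the integers $k_1,k_2$ range over $0 \le n-1-k_1 \le k_2 \le k_1-2$. In particular, $$\mathscr{P}_{n,2}=\bigoplus_{l=0}^{2n-4} \mathscr{P}_{n, 2, l} \quad \text{and} \quad \dim \mathscr{P}_{n,2}=\binom{n}{2}.$$
   Context: Fix a point $t_0\in S^1$. For a complex manifold $M$, $J^k(t_0,M)$ denotes the complex manifold of $k$-jets $j^k_{t_0}x$ at $t_0$ of $C^\infty$ maps $x:S^1\to M$, and $\tau_k:J^k(t_0,M)\to M$, $j^k_{t_0}x\mapsto x(t_0)$, is the target map. Write $\mathbb{P}^1=\mathbb{C}\cup\{\infty\}$. The set $J^{n-1}(t_0,\mathbb{C})$ is a dense open subset of $J^{n-1}(t_0,\mathbb{P}^1)$ and is identified with $\mathbb{C}^n$ through the coordinates $(x(t_0),x^{(1)}(t_0),\dots,x^{(n-1)}(t_0))$, where $x^{(\nu)}$ is the $\nu$-th derivative of $x$ and $x^{(0)}=x$. For $n\ge 1$ let $\mathfrak{L}_n=\tau_{n-1}^*\mathcal{O}(n)$, a holomorphic line bundle on $J^{n-1}(t_0,\mathbb{P}^1)$.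 Fix a holomorphic section $\mathfrak{S}_\infty\in H^0(\mathbb{P}^1,\mathcal{O}(n))$ whose only zero is $\infty$. Let $\mathscr{P}_n$ be the range of the linear operator $$H^0(J^{n-1}(t_0,\mathbb{P}^1),\mathfrak{L}_n)\ni\varsigma\mapsto \left.\frac{\varsigma}{\tau_{n-1}^*\mathfrak{S}_\infty}\right|_{J^{n-1}(t_0,\mathbb{C})}\in\mathcal{O}(J^{n-1}(t_0,\mathbb{C})).$$ It is known that every element of $\mathscr{P}_n$ is a polynomial of degree at most $n$ in $x(t_0),\dots,x^{(n-1)}(t_0)$. For $0\le d\le n$, $\mathscr{P}_{n,d}\subset\mathscr{P}_n$ is the subspace of homogeneous polynomials of degree $d$ (together with $0$). The order of derivatives of a monomial $c\,x^{(r_1)}(t_0)\cdots x^{(r_m)}(t_0)$ with $c\ne0$ is $r_1+\cdots+r_m$ (and it is $0$ for a non-zero constant). $\mathscr{P}_{n,d,l}\subset\mathscr{P}_{n,d}$ is the subspace spanned by the polynomials $\rho\in\mathscr{P}_{n,d}$ such that every monomial in $\rho$ has order of derivatives equal to $l$. *)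

(* Defs.v *)
From HB Require Import structures.
From mathcomp Require Import all_boot all_order all_algebra.
From mathcomp Require Import all_classical all_reals all_analysis.
From mathcomp Require Import complex.
(* The notations of mpoly clash with those of MathComp-Analysis, and some of its
   names with those of ssrbool. *)
From mathcomp Require mpoly.
Import (canonicals, coercions) mpoly.

Set Implicit Arguments.
Unset Strict Implicit.
Unset Printing Implicit Defensive.

Import Order.TTheory GRing.Theory Num.Theory.
Import numFieldNormedType.Exports.

Local Open Scope classical_set_scope.
Local Open Scope quotient_scope.
Local Open Scope ring_scope.

(* mathcomp's vector spaces are finite dimensional; {mpoly K[n]} is not. *)

Section LinearAlgebra.
Context {K : fieldType} {V : lmodType K}.

Definition lin_span (A : set V) : set V :=
  [set v | exists (s : seq V) (c : V -> K),
     (forall w, w \in s -> A w) /\ v = \sum_(w <- s) c w *: w].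

Definition lin_indep (A : set V) : Prop :=
  forall (s : seq V) (c : V -> K), uniq s -> (forall w, w \in s -> A w) ->
    \sum_(w <- s) c w *: w = 0 -> forall w, w \in s -> c w = 0.

Definition is_basis (B W : set V) : Prop := lin_indep B /\ lin_span B = W.

Definition has_dim (W : set V) (d : nat) : Prop :=
  exists s : seq V, [/\ uniq s, size s = d & is_basis [set` s] W].

Definition is_direct_sum (W : set V) (N : nat) (U : 'I_N -> set V) : Prop :=
  W = [set v | exists2 u : 'I_N -> V, forall l, U l (u l) & v = \sum_l u l] /\
  forall u : 'I_N -> V, (forall l, U l (u l)) -> \sum_l u l = 0 ->
    forall l, u l = 0.

End LinearAlgebra.

Section ProjectiveLine.
Variable R : realType.
Local Notation C := R[i].

(* [None] is the point at infinity. *)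
Definition P1 := option C.

(* [Fin] is the chart z on P1 \ {oo}, [Inf] the chart 1/z on P1 \ {0}. *)
Inductive chart := Fin | Inf.

Definition chart_dom (i : chart) (p : P1) : Prop :=
  match i with Fin => p <> None | Inf => p <> Some 0 end.

(* The value of a chart outside its domain is irrelevant. *)
Definition chart_map (i : chart) (p : P1) : C :=
  match i, p with
  | Fin, Some z => z
  | Fin, None => 0
  | Inf, Some z => z^-1
  | Inf, None => 0
  end.

Definition holomorphic (m : nat) (h : 'rV[C]_m -> C) : Prop :=
  forall v, differentiable (h : 'rV[C]_m -> C^o) v.

(* The line bundle O(n) has a frame over the domain of each chart, and the
   components of a section in the two frames are related by
   s_Fin = z ^ n s_Inf.  Here X is a complex manifold, tau a map from X to P1
   and [coord i] a holomorphic chart from tau^-1 (chart_dom i) onto C^m;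
   [hol_section n tau coord s] says that s is a holomorphic section of
   tau^* O(n), given by its components s i : X -> C in the pulled back frames.
   Only the restriction of s i to tau^-1 (chart_dom i) matters. *)
Definition hol_section (n : nat) (X : Type) (m : nat) (tau : X -> P1)
    (coord : chart -> X -> 'rV[C]_m) (s : chart -> X -> C) : Prop :=
  (forall i, exists2 h : 'rV[C]_m -> C, holomorphic h &
     forall x, chart_dom i (tau x) -> s i x = h (coord i x)) /\
  (forall x, chart_dom Fin (tau x) -> chart_dom Inf (tau x) ->
     s Fin x = chart_map Fin (tau x) ^+ n * s Inf x).

(* Elements of H^0(P1, O(n)) *)
Definition hol_section_P1 (n : nat) (s : chart -> P1 -> C) : Prop :=
  hol_section n id (fun i p => \row_(_ < 1) chart_map i p) s.

Definition section_zero (s : chart -> P1 -> C) (p : P1) : Prop :=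
  forall i, chart_dom i p -> s i p = 0.

(* S^1 is R/Z: maps on S^1 are 1-periodic maps on R, and [t0 : R] stands for
   its class. *)

Definition derivC (nu : nat) (f : R -> C) (t : R) : C :=
  Complex (derive1n nu (fun u => complex.Re (f u)) t)
          (derive1n nu (fun u => complex.Im (f u)) t).

Definition smooth (x : R -> P1) : Prop :=
  forall s : R, exists i : chart, \forall t \near s,
    chart_dom i (x t) /\
    forall nu : nat,
      derivable (derive1n nu (fun u => complex.Re (chart_map i (x u)))) t 1 /\
      derivable (derive1n nu (fun u => complex.Im (chart_map i (x u)))) t 1.

Record loop := Loop {
  loop_fun :> R -> P1;
  loop_smooth : smooth loop_fun;
  loop_periodic : forall t, loop_fun (t + 1) = loop_fun t }.

HB.instance Definition _ := gen_eqMixin loop.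
HB.instance Definition _ := gen_choiceMixin loop.

Section Jets.
Variables (k : nat) (t0 : R).

Definition same_jet : rel loop := fun x y =>
  `[< x t0 = y t0 /\
      forall i, chart_dom i (x t0) -> forall nu, (nu <= k)%N ->
        derivC nu (chart_map i \o x) t0 = derivC nu (chart_map i \o y) t0 >].

Lemma same_jet_refl : reflexive same_jet.
Proof. by move=> x; apply/asboolP. Qed.

Lemma same_jet_sym : symmetric same_jet.
Proof.
move=> x y; apply/asboolP/asboolP => -[xy h]; split=> // i di nu lenu;
  by rewrite h ?xy // -?xy.
Qed.

Lemma same_jet_trans : transitive same_jet.
Proof.
move=> y x z /asboolP[xy h1] /asboolP[yz h2]; apply/asboolP.
split; first by rewrite xy.
by move=> i di nu lenu; rewrite h1 // h2 // -xy.
Qed.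

Canonical same_jet_equiv :=
  EquivRel same_jet same_jet_refl same_jet_sym same_jet_trans.

Definition jet := {eq_quot same_jet_equiv}.

Definition jet_target (j : jet) : P1 := (repr j : loop) t0.

End Jets.

Section JetSections.
Variables (n : nat) (t0 : R).

(* The coordinates (x(t0), ..., x^(n-1)(t0)) of a jet whose target is in the
   domain of the chart i, where x is read in this chart.  They are the charts
   of the complex manifold J^(n-1)(t0, P1), and [jet_coord Fin] identifies
   J^(n-1)(t0, C) with C^n. *)
Definition jet_coord (i : chart) (j : jet n.-1 t0) : 'rV[C]_n :=
  \row_(nu < n) derivC nu (chart_map i \o (repr j : loop)) t0.

(* Elements of H^0(J^(n-1)(t0, P1), L_n) *)
Definition hol_section_jet (s : chart -> jet n.-1 t0 -> C) : Prop :=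
  hol_section n (@jet_target n.-1 t0) jet_coord s.

Variable Sinf : chart -> P1 -> C.

(* The space P_n, as a set of functions on C^n = J^(n-1)(t0, C).  Over
   J^(n-1)(t0, C) a quotient of sections is the quotient of their components in
   the frame [Fin]. *)
Definition Pn : set ('rV[C]_n -> C) :=
  [set f | exists2 s, hol_section_jet s &
     forall j, chart_dom Fin (jet_target j) ->
       f (jet_coord Fin j) = s Fin j / Sinf Fin (jet_target j)].

(* The variable of index i stands for x^(i)(t0). *)
Definition jpoly := mpoly.mpoly n C.

Definition jpoly_fun (p : jpoly) (v : 'rV[C]_n) : C :=
  mpoly.meval (fun i => v 0 i) p.

Definition Pnd (d : nat) : set jpoly :=
  [set p | p \is mpoly.ishomog1 d (@mpoly.mdeg n) /\ Pn (jpoly_fun p)].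

Definition deriv_order (m : mpoly.multinom n) : nat := (\sum_(i < n) m i * i)%N.

Definition Pndl (d l : nat) : set jpoly :=
  lin_span [set p | Pnd d p /\
    forall m, m \in mpoly.msupp p -> deriv_order m = l].

End JetSections.

(* The variable x^(r)(t0), for r < n; the value for r >= n is irrelevant. *)
Definition xder (n r : nat) : jpoly n :=
  oapp (fun i : 'I_n => mpoly.mpolyX C (mpoly.mnm1 i)) 0 (insub r).

Definition basis_n2 (n : nat) : set (jpoly n) :=
  [set p | exists r1 r2 : nat,
     [/\ (r2 <= r1)%N, (r1 + r2 + 2 <= n)%N & p = xder n r1 * xder n r2]] `|`
  [set p | exists k1 k2 : nat,
     [/\ (k1 <= n - 1)%N, (n - 1 - k1 <= k2)%N, (k2 + 2 <= k1)%N &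
       p = xder n k1 * xder n k2 -
           (k1%:R / (k2 + 1)%:R) *: (xder n (k1 - 1) * xder n (k2 + 1))]].

End ProjectiveLine.

Arguments xder : clear implicits.
Arguments basis_n2 : clear implicits.
Arguments Pn {R} n t0 Sinf.
Arguments Pnd {R} n t0 Sinf d.
Arguments Pndl {R} n t0 Sinf d l.

(* Main.v *)
(* Over J^(n-1)(t0, C), P_n consists of the holomorphic functions f such that
   w_0^n f(jet of 1/w) extends holomorphically across w_0 = 0: an entire function
   h without zeros such that z^-n h(z) is bounded near infinity is constant, so the
   section with only zero oo is constant in the frame over C.  With Taylor
   coefficients y_r = x^(r)/r!, the product y_a y_b of the coefficients of 1/w has a
   pole of order a + b + 2 along w_0 = 0, whereas y_a y_b - y_(a-1) y_(b+1) with
   b + 2 <= a, a 2x2 minor of the inverse of a Toeplitz matrix of size a + 1, has a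
   pole of order at most a + 1.  Conversely, restricting to w = z + t, where
   y_r = (-1)^r / z^(r+1), shows that in each weight l >= n - 1 the sum of the
   coefficients of an element of P_n in the monomials y_a y_b vanishes. *)
Require Import Defs.
From HB Require Import structures.
From mathcomp Require Import all_boot all_order all_algebra.
From mathcomp Require Import all_classical all_reals all_analysis.
From mathcomp Require Import complex.
From mathcomp Require Import ring lra zify.
From mathcomp Require mpoly.
Import (canonicals, coercions) mpoly.
(* [derivC] is also the name of a lemma on polynomials. *)
Import Defs.

Set Implicit Arguments.
Unset Strict Implicit.
Unset Printing Implicit Defensive.

Import Order.TTheory GRing.Theory Num.Theory.
Import numFieldNormedType.Exports.
Local Open Scope classical_set_scope.
Local Open Scope quotient_scope.
Local Open Scope ring_scope.

(** * Goursat's theorem for closed 1-forms on the plane *)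

(** Holomorphy of [Sinf] is complex differentiability at every point, with nothing on continuity of
    the derivative; this is why its constancy in the frame over C is derived from Goursat's
    bisection. Circles are handled through w -> h (z + exp w): vertical segments of height 2 pi are
    mapped to circles, and periodicity cancels the horizontal sides of rectangles. Complex numbers
    are bounded through their real and imaginary parts separately, which costs a factor 2 but needs
    only real integrals and the real mean value theorem. On the jet side the two inclusions meet
    exactly. In a weight l >= n - 1 the basis elements are multiples of consecutive differences of
    the products y_a y_b; they span the kernel of the sum of coefficients, so the single relation
    found on w = z + t suffices. That relation can be tested because every coordinate vector with
    nonzero first entry comes from the jet of a loop. *)

Section RealGoursat.
Context {R : realType}.
Implicit Types (f g : R -> R) (P Q : R -> R -> R).
Local Notation mu := (@lebesgue_measure R).

(** The base point [a] lies to the left of every point in use, so that oriented integrals are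
    differences of values of [prim a f]. *)
Definition prim (a : R) f (x : R) : R := (\int[mu]_(t in [set` `[a, x]]) f t)%R.

Lemma is_derive_prim (a : R) f (x : R) : continuous f -> a < x ->
  is_derive x 1 (prim a f) (f x).
Proof.
move=> cf ax.
have xu : x < x + 1 by lra.
have fi : mu.-integrable `[a, x + 1] (EFin \o f).
  apply: continuous_compact_integrable; first exact: segment_compact.
  by apply: continuous_subspaceT.
have [d e] := continuous_FTC1_closed xu fi ax (cf x).
by apply: DeriveDef; [exact: d | rewrite -derive1E; exact: e].
Qed.

(** The mean value theorem for the difference of the primitives minus a linear function. It compares
    the integrals along opposite sides of a small rectangle, where the integrands differ by almost a
    constant. *)
Lemma prim_diff_bound (a : R) f g (s t m e : R) : continuous f -> continuous g ->
  a < s -> s <= t ->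
  (forall x, s <= x <= t -> `|f x - g x - m| <= e) ->
  `|(prim a f t - prim a f s) - (prim a g t - prim a g s) - m * (t - s)|
    <= e * (t - s).
Proof.
move=> cf cg as_ st hb.
pose k : R -> R := fun x => prim a f x - prim a g x - m * x.
have dk x : a < x -> is_derive x 1 k (f x - g x - m).
  move=> ax.
  have df := is_derive_prim cf ax.
  have dg := is_derive_prim cg ax.
  have di : is_derive x 1 (fun y : R => m * y) m.
    by apply: is_derive_eq; rewrite /GRing.scale /= mulr1.
  have := @is_deriveB _ _ _ _ _ _ _ _ _ (@is_deriveB _ _ _ _ _ _ _ _ _ df dg) di.
  by [].
have [||c cI kE] := @MVT_segment _ k (fun x => f x - g x - m) s t st.
- move=> x; rewrite in_itv /= => /andP[sx _]; apply: dk; exact: lt_trans sx.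
- apply: derivable_within_continuous => x; rewrite in_itv /= => /andP[sx _].
  by apply: (@ex_derive _ _ _ _ _ _ _ (dk x _)); apply: lt_le_trans sx.
have -> : (prim a f t - prim a f s) - (prim a g t - prim a g s) - m * (t - s)
  = k t - k s by rewrite /k; ring.
rewrite kE normrM (ger0_norm (x := t - s)) ?subr_ge0 //.
by rewrite ler_wpM2r ?subr_ge0 // hb //; move: cI; rewrite in_itv.
Qed.

(** The integral of P dx + Q dy along the counterclockwise boundary of [x, x + p] x [y, y + q]. *)
Definition rect_bdry a P Q (x y p q : R) : R :=
  (prim a (Q (x + p)) (y + q) - prim a (Q (x + p)) y)
  - (prim a (Q x) (y + q) - prim a (Q x) y)
  - ((prim a (P^~ (y + q)) (x + p) - prim a (P^~ (y + q)) x)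
     - (prim a (P^~ y) (x + p) - prim a (P^~ y) x)).

Lemma rect_bdry_half (a : R) P Q (x y p q : R) :
  rect_bdry a P Q x y p q =
    rect_bdry a P Q x y (p / 2) (q / 2)
    + rect_bdry a P Q (x + p / 2) y (p / 2) (q / 2)
    + rect_bdry a P Q x (y + q / 2) (p / 2) (q / 2)
    + rect_bdry a P Q (x + p / 2) (y + q / 2) (p / 2) (q / 2).
Proof.
have h (u v : R) : u + v / 2 + v / 2 = u + v by field.
by rewrite /rect_bdry !h; ring.
Qed.

(** One of the four quarters carries at least a quarter of the boundary integral; [z] is its lower
    left corner. *)
Lemma rect_bdry_step (a : R) P Q (x y p q : R) : 0 <= p -> 0 <= q ->
  exists z : R * R, [/\ x <= z.1, z.1 + p / 2 <= x + p, y <= z.2,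
    z.2 + q / 2 <= y + q &
    `|rect_bdry a P Q x y p q| <= 4 * `|rect_bdry a P Q z.1 z.2 (p / 2) (q / 2)|].
Proof.
move=> p0 q0; rewrite rect_bdry_half.
set b1 := rect_bdry _ _ _ x y _ _; set b2 := rect_bdry _ _ _ (x + _) y _ _.
set b3 := rect_bdry _ _ _ x (y + _) _ _.
set b4 := rect_bdry _ _ _ (x + _) (y + _) _ _.
set b := b1 + b2 + b3 + b4.
have hb : `|b| <= `|b1| + `|b2| + `|b3| + `|b4|.
  apply: (le_trans (ler_normD _ _)); rewrite lerD2r.
  by apply: (le_trans (ler_normD _ _)); rewrite lerD2r ler_normD.
have [h1|h1] := leP `|b| (4 * `|b1|).
  by exists (x, y); split => //=; clear - p0 q0; lra.
have [h2|h2] := leP `|b| (4 * `|b2|).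
  by exists (x + p / 2, y); split => //=; clear - p0 q0; lra.
have [h3|h3] := leP `|b| (4 * `|b3|).
  by exists (x, y + q / 2); split => //=; clear - p0 q0; lra.
have [h4|h4] := leP `|b| (4 * `|b4|).
  by exists (x + p / 2, y + q / 2); split => //=; clear - p0 q0; lra.
by exfalso; clear - hb h1 h2 h3 h4; lra.
Qed.

(* al = P_x, be = P_y = Q_x, ga = Q_y *)
Definition closed_form_at P Q (x y : R) := exists al be ga : R, forall e, 0 < e ->
  exists2 d, 0 < d & forall a b, `|a| <= d -> `|b| <= d ->
    `|P (x + a) (y + b) - P x y - al * a - be * b| <= e * (`|a| + `|b|) /\
    `|Q (x + a) (y + b) - Q x y - be * a - ga * b| <= e * (`|a| + `|b|).

Lemma nested_point (x_ l_ : nat -> R) : (forall k, 0 <= l_ k) ->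
  (forall k, x_ k <= x_ k.+1 /\ x_ k.+1 + l_ k.+1 <= x_ k + l_ k) ->
  exists z, forall k, x_ k <= z <= x_ k + l_ k.
Proof.
move=> l0 h.
have mono i j : x_ i <= x_ (i + j)%N /\ x_ (i + j)%N + l_ (i + j)%N <= x_ i + l_ i.
  elim: j => [|j [h1 h2]]; first by rewrite addn0.
  rewrite addnS; have [h3 h4] := h (i + j)%N.
  by split; [exact: le_trans h3 | exact: le_trans h2].
have key i j : x_ i <= x_ j + l_ j.
  have [ij|/ltnW ij] := leqP i j.
    have [h1 _] := mono i (j - i)%N; rewrite subnKC // in h1.
    by have := l0 j; lra.
  have [_ h2] := mono j (i - j)%N; rewrite subnKC // in h2.
  by have := l0 i; lra.
exists (sup (range x_)) => k; apply/andP; split.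
  apply: ub_le_sup; last by exists k.
  by exists (x_ 0%N + l_ 0%N) => _ [i _ <-].
by apply: ge_sup; [exists (x_ 0%N); exists 0%N | move=> _ [i _ <-]].
Qed.

(** Bisection leads to rectangles shrinking to a point. There the linear part of a closed form has
    boundary integral zero, and the remainder is small compared with the area scale 4^-k, by which
    the integral shrinks at most. *)
Lemma goursat (a : R) P Q (x y p q : R) :
  (forall u, continuous (P^~ u)) -> (forall u, continuous (Q u)) ->
  (forall u v, closed_form_at P Q u v) ->
  a < x -> a < y -> 0 <= p -> 0 <= q -> rect_bdry a P Q x y p q = 0.
Proof.
move=> cP cQ hPQ ax ay p0 q0.
pose s k : R := (2 ^+ k)^-1.
have sS k : s k.+1 = s k / 2 by rewrite /s exprS invfM mulrC.
have s0 k : 0 < s k by rewrite invr_gt0 exprn_gt0.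
(* A state is a depth k together with the lower left corner of the rectangle at that depth. *)
have /choice[stp hstp] : forall u : nat * (R * R), exists z : R * R,
    [/\ u.2.1 <= z.1, z.1 + p * s u.1.+1 <= u.2.1 + p * s u.1,
     u.2.2 <= z.2, z.2 + q * s u.1.+1 <= u.2.2 + q * s u.1 &
    `|rect_bdry a P Q u.2.1 u.2.2 (p * s u.1) (q * s u.1)| <=
    4 * `|rect_bdry a P Q z.1 z.2 (p * s u.1.+1) (q * s u.1.+1)|].
  case=> k [u v] /=.
  have [z hz] := @rect_bdry_step a P Q u v (p * s k) (q * s k)
    (mulr_ge0 p0 (ltW (s0 k))) (mulr_ge0 q0 (ltW (s0 k))).
  by exists z; rewrite sS !mulrA.
pose z_ := fix z_ k := if k is k'.+1 then stp (k', z_ k') else (x, y).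
have hz k : [/\ (z_ k).1 <= (z_ k.+1).1,
     (z_ k.+1).1 + p * s k.+1 <= (z_ k).1 + p * s k,
     (z_ k).2 <= (z_ k.+1).2, (z_ k.+1).2 + q * s k.+1 <= (z_ k).2 + q * s k &
    `|rect_bdry a P Q (z_ k).1 (z_ k).2 (p * s k) (q * s k)| <=
    4 * `|rect_bdry a P Q (z_ k.+1).1 (z_ k.+1).2 (p * s k.+1) (q * s k.+1)|].
  exact: (hstp (k, z_ k)).
have [xs hxs] : exists xs, forall k, (z_ k).1 <= xs <= (z_ k).1 + p * s k.
  apply: nested_point => k; first by rewrite mulr_ge0 // ltW.
  by have [? ? _ _ _] := hz k.
have [ys hys] : exists ys, forall k, (z_ k).2 <= ys <= (z_ k).2 + q * s k.
  apply: nested_point => k; first by rewrite mulr_ge0 // ltW.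
  by have [_ _ ? ? _] := hz k.
have z_gt k : a < (z_ k).1 /\ a < (z_ k).2.
  elim: k => [//|k [h1 h2]]; have [h3 _ h4 _ _] := hz k.
  by split; [exact: lt_le_trans h3 | exact: lt_le_trans h4].
have B4 k : `|rect_bdry a P Q x y p q| * s k * s k <=
    `|rect_bdry a P Q (z_ k).1 (z_ k).2 (p * s k) (q * s k)|.
  elim: k => [|k IH]; first by rewrite /s expr0 invr1 !mulr1.
  have [_ _ _ _ h] := hz k; move: (le_trans IH h).
  set B := `|rect_bdry _ _ _ x y _ _|; set B' := `|rect_bdry _ _ _ (z_ _.+1).1 _ _ _|.
  rewrite sS => h'; have -> : B * (s k / 2) * (s k / 2) = B * s k * s k / 4 by field.
  by rewrite ler_pdivrMr //; lra.
have [al [be [ga hd]]] := hPQ xs ys.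
have key e : 0 < e -> `|rect_bdry a P Q x y p q| <= e * (2 * (p + q) ^+ 2).
  move=> e0; have [d d0 hd'] := hd e e0.
  have [k hk] : exists k, (p + q) * s k <= d.
    exists (Num.bound ((p + q) / d)).
    rewrite /s ler_pdivrMr ?exprn_gt0 // mulrC -ler_pdivrMr //.
    apply: ltW; apply: lt_trans (archi_boundP _) _; first by rewrite divr_ge0 ?addr_ge0 // ltW.
    by rewrite -natrX ltr_nat ltn_expl.
  set X := (z_ k).1 in hk *; set Y := (z_ k).2.
  have := hxs k; have := hys k; rewrite -/X -/Y => /andP[y1 y2] /andP[x1 x2].
  set pk := p * s k in x2; set qk := q * s k in y2.
  have pk0 : 0 <= pk by rewrite mulr_ge0 // ltW.
  have qk0 : 0 <= qk by rewrite mulr_ge0 // ltW.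
  have pqk : pk + qk <= d by move: hk; rewrite mulrDl.
  have approx u v : X <= u <= X + pk -> Y <= v <= Y + qk ->
     `|P u v - P xs ys - al * (u - xs) - be * (v - ys)| <= e * (pk + qk) /\
     `|Q u v - Q xs ys - be * (u - xs) - ga * (v - ys)| <= e * (pk + qk).
    move=> /andP[u1 u2] /andP[v1 v2].
    have ua : `|u - xs| <= pk.
      by clear - u1 u2 x1 x2; rewrite ler_norml; apply/andP; split; lra.
    have va : `|v - ys| <= qk.
      by clear - v1 v2 y1 y2; rewrite ler_norml; apply/andP; split; lra.
    have [||h1 h2] := hd' (u - xs) (v - ys).
    - by clear - ua qk0 pqk; lra.
    - by clear - va pk0 pqk; lra.
    rewrite !subrKC in h1 h2.
    have le_e : e * (`|u - xs| + `|v - ys|) <= e * (pk + qk).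
      by apply: ler_wpM2l; [exact: ltW | exact: lerD].
    by split; [exact: le_trans h1 _ | exact: le_trans h2 _].
  (* The linear parts differ by be * pk between the vertical sides and by be * qk between the
     horizontal ones. After integration both give be * pk * qk, and they cancel because P_y =
     Q_x. *)
  have b1 := @prim_diff_bound a (Q (X + pk)) (Q X) Y (Y + qk) (be * pk)
    (2 * (e * (pk + qk))) (cQ _) (cQ _) (z_gt k).2.
  have b2 := @prim_diff_bound a (P^~ (Y + qk)) (P^~ Y) X (X + pk) (be * qk)
    (2 * (e * (pk + qk))) (cP _) (cP _) (z_gt k).1.
  have {}b1 : `|prim a (Q (X + pk)) (Y + qk) - prim a (Q (X + pk)) Y
     - (prim a (Q X) (Y + qk) - prim a (Q X) Y) - be * pk * (Y + qk - Y)|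
     <= 2 * (e * (pk + qk)) * (Y + qk - Y).
    apply: b1; first by clear - qk0; lra.
    move=> v hv.
    have [|_ h1] := approx (X + pk) v _ hv; first by clear - pk0 qk0; apply/andP; split; lra.
    have [|_ h2] := approx X v _ hv; first by clear - pk0 qk0; apply/andP; split; lra.
    move: h1 h2; clear; rewrite !ler_norml => /andP[? ?] /andP[? ?].
    by apply/andP; split; lra.
  have {}b2 : `|prim a (P^~ (Y + qk)) (X + pk) - prim a (P^~ (Y + qk)) X
     - (prim a (P^~ Y) (X + pk) - prim a (P^~ Y) X) - be * qk * (X + pk - X)|
     <= 2 * (e * (pk + qk)) * (X + pk - X).
    apply: b2; first by clear - pk0; lra.
    move=> u hu.
    have [|h1 _] := approx u (Y + qk) hu _; first by clear - pk0 qk0; apply/andP; split; lra.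
    have [|h2 _] := approx u Y hu _; first by clear - pk0 qk0; apply/andP; split; lra.
    move: h1 h2; clear; rewrite !ler_norml => /andP[? ?] /andP[? ?].
    by apply/andP; split; lra.
  have bk : `|rect_bdry a P Q X Y pk qk| <= 2 * e * (pk + qk) ^+ 2.
    have E1 : Y + qk - Y = qk by ring.
    have E2 : X + pk - X = pk by ring.
    rewrite E1 in b1; rewrite E2 in b2.
    rewrite /rect_bdry.
    move: b1 b2; clear; rewrite !ler_norml => /andP[? ?] /andP[? ?].
    have E3 : 2 * e * (pk + qk) ^+ 2 =
      2 * (e * (pk + qk)) * qk + 2 * (e * (pk + qk)) * pk by ring.
    by rewrite E3; apply/andP; split; lra.
  have := le_trans (B4 k) bk.
  have -> : 2 * e * (pk + qk) ^+ 2 = e * (2 * (p + q) ^+ 2) * s k * s k.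
    by rewrite /pk /qk; ring.
  by rewrite !ler_pM2r.
apply/eqP; rewrite -normr_le0; apply/ler_addgt0Pr => e e0; rewrite add0r.
have C0 : 0 < 2 * (p + q) ^+ 2 + 1.
  by rewrite ltr_wpDl // mulr_ge0 // sqr_ge0.
have := key (e / (2 * (p + q) ^+ 2 + 1)) (divr_gt0 e0 C0).
move=> /le_trans; apply.
rewrite mulrAC ler_pdivrMr // ler_pM2l //; lra.
Qed.

End RealGoursat.

(** * Closed forms that are periodic in the vertical direction *)

Section RealGoursatPeriodic.
Context {R : realType}.
Implicit Types (f g : R -> R) (P Q : R -> R -> R).

Lemma closed_form_continuous P Q : (forall u v, closed_form_at P Q u v) ->
  (forall v, continuous (P^~ v)) /\ (forall u, continuous (Q u)).
Proof.
have bnd (al r e a : R) : `|r - al * a| <= 1 * `|a| -> `|a| <= e / (`|al| + 1) ->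
    `|r| <= e.
  move=> h1 h2; have k0 : 0 < `|al| + 1 by rewrite ltr_wpDl.
  rewrite -[r](subrK (al * a)); apply: le_trans (ler_normD _ _) _.
  apply: (@le_trans _ _ ((`|al| + 1) * `|a|)).
    by rewrite mulrDl addrC normrM lerD2l.
  by rewrite mulrC -ler_pdivlMr.
move=> hPQ; split=> [v u|u v]; have [al [be [ga /(_ 1 ltr01)[d d0 hd]]]] := hPQ u v.
- apply/cvgrPdist_le => e e0; apply/(@nbhs0P R R^o).
  have e1 : 0 < e / (`|al| + 1) by rewrite divr_gt0 // ltr_wpDl.
  near=> a.
  have ad : `|a| <= d by near: a; exact: (@nbhs0_le R R^o).
  have ae : `|a| <= e / (`|al| + 1) by near: a; exact: (@nbhs0_le R R^o).
  rewrite distrC; apply: (bnd al _ _ a) => //.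
  have [|+ _] := hd a 0 ad; first by rewrite normr0 ltW.
  by rewrite !addr0 mulr0 subr0 normr0 addr0.
- apply/cvgrPdist_le => e e0; apply/(@nbhs0P R R^o).
  have e1 : 0 < e / (`|ga| + 1) by rewrite divr_gt0 // ltr_wpDl.
  near=> a.
  have ad : `|a| <= d by near: a; exact: (@nbhs0_le R R^o).
  have ae : `|a| <= e / (`|ga| + 1) by near: a; exact: (@nbhs0_le R R^o).
  rewrite distrC; apply: (bnd ga _ _ a) => //.
  have [|_ +] := hd 0 a _ ad; first by rewrite normr0 ltW.
  by rewrite !addr0 mulr0 subr0 normr0 add0r.
Unshelve. all: by end_near. Qed.

(* By periodicity the horizontal sides of a rectangle of height T cancel. *)
Lemma goursat_periodic P Q (T x1 x2 : R) : 0 <= T ->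
  (forall u v, closed_form_at P Q u v) ->
  (forall u, P u T = P u 0) -> x1 <= x2 ->
  exists F1 F2 : R -> R, [/\ forall t : R, 0 <= t -> is_derive t 1 F1 (Q x1 t),
    forall t : R, 0 <= t -> is_derive t 1 F2 (Q x2 t) & F1 T - F1 0 = F2 T - F2 0].
Proof.
move=> T0 hPQ PT x12; have [cP cQ] := closed_form_continuous hPQ.
pose a := Num.min x1 0 - 1.
have ax : a < x1 by rewrite /a; case: (leP x1 0) => ?; lra.
have a0 : a < 0 by rewrite /a; case: (leP x1 0) => ?; lra.
exists (prim a (Q x1)), (prim a (Q x2)); split.
- by move=> t t0; apply: is_derive_prim => //; exact: lt_le_trans t0.
- by move=> t t0; apply: is_derive_prim => //; exact: lt_le_trans t0.
have := @goursat R a P Q x1 0 (x2 - x1) T cP cQ hPQ ax a0 _ T0.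
rewrite subr_ge0 => /(_ x12); rewrite /rect_bdry add0r subrKC.
have -> : P^~ T = P^~ 0 by apply/funext => u.
by lra.
Qed.

End RealGoursatPeriodic.

(** * Entire functions of one variable *)

(** Stated over any numeric field because it is applied both to real functions (exp, cos, sin, real
    parts along segments) and to complex ones. *)
Lemma is_derive_epsP (K : numFieldType) (h : K -> K) (z d : K) :
  is_derive (z : K^o) (1 : K^o) (h : K^o -> K^o) (d : K^o) <->
  forall e : K, 0 < e -> exists2 r : K, 0 < r & forall c, `|c| <= r ->
    `|h (z + c) - h z - d * c| <= e * `|c|.
Proof.
pose q : K^o -> K^o := fun c =>
  c^-1 *: (((h : K^o -> K^o) \o shift (z : K^o)) (c *: (1 : K^o)) - h z).
have quot c : c != 0 -> `|d - q c| = `|h (z + c) - h z - d * c| / `|c|.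
  move=> c0; rewrite -normfV -normrM distrC; congr `|_|.
  rewrite /q /= /shift /= /GRing.scale /= mulr1 [c + z]addrC mulrBl mulfK //.
  by rewrite mulrC.
have step1 : (forall e : K, 0 < e -> exists2 r : K, 0 < r & forall c, `|c| <= r ->
    `|h (z + c) - h z - d * c| <= e * `|c|) <->
    q c @[c --> (0 : K^o)^'] --> (d : K^o).
  split=> [hd|hd e e0].
  - apply/cvgrPdist_le => e e0.
    have [r r0 hr] := hd _ e0.
    near=> c.
    have c0 : c != 0 by near: c; exact: nbhs_dnbhs_neq.
    have cr : `|c| <= r by near: c; exact: (@dnbhs0_le _ K^o).
    by rewrite quot // ler_pdivrMr ?normr_gt0 // hr.
  - have /cvgrPdist_le/(_ _ e0) := hd.
    rewrite near_withinE => /nbhs_ballP[r /= r0 hr].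
    exists (r / 2); first by rewrite divr_gt0.
    move=> c cr; have [->|c0] := eqVneq c 0.
      by rewrite addr0 subrr mulr0 subr0 normr0 mulr0.
    have := hr c; rewrite -ball_normE /= sub0r normrN => /(_ _ c0).
    rewrite quot // => hc; rewrite -ler_pdivrMr ?normr_gt0 //.
    apply: hc; apply: le_lt_trans cr _.
    by rewrite ltr_pdivrMr // ltr_pMr // ltr1n.
rewrite step1; split=> [[dh <-] //|hq].
by apply: DeriveDef; [apply/cvg_ex; exists d | exact: (cvg_lim _ hq)].
Unshelve. all: by end_near. Qed.

Section ComplexDerivative.
Context {R : realType}.
Local Notation C := R[i].
Local Notation nc := (@Normc.normc R).
Implicit Types (h : C -> C) (z c : C).

Lemma normcC z : `|z| = (nc z)%:C%C.
Proof. by rewrite normc_def; case: z. Qed.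

Lemma gt0_realC (x : C) : 0 < x -> x = (complex.Re x)%:C%C /\ 0 < complex.Re x.
Proof. by rewrite ltcE /= => /andP[/eqP + ->]; case: x => a b /= ->. Qed.

Lemma normc_ge0 z : 0 <= nc z. Proof. by rewrite -lecR -normcC normr_ge0. Qed.

Lemma normc_triangle z c : nc (z + c) <= nc z + nc c.
Proof. exact: le_normcD. Qed.

Lemma normc_opp z : nc (- z) = nc z. Proof. exact: normcN. Qed.

Lemma Re_le_normc z : `|complex.Re z| <= nc z.
Proof. by have := normc_ge_Re z; rewrite normcC lecR. Qed.

Lemma normc_i : nc ('i)%C = 1.
Proof. by rewrite /= expr0n /= expr1n add0r sqrtr1. Qed.

Lemma normc_real (x : R) : nc x%:C%C = `|x|.
Proof. by rewrite /= expr0n /= addr0 sqrtr_sqr. Qed.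

Lemma Im_le_normc z : `|complex.Im z| <= nc z.
Proof.
have := Re_le_normc (z * ('i)%C); rewrite Normc.normcM normc_i mulr1.
by rewrite ReiNIm normrN.
Qed.

Lemma normc_le_ReIm z : nc z <= `|complex.Re z| + `|complex.Im z|.
Proof.
rewrite {1}(complexE z); apply: le_trans (normc_triangle _ _) _.
by rewrite Normc.normcM normc_i mul1r !normc_real.
Qed.

(** The complex derivative with real radii and real-valued modulus: the order of C is only
    partial. *)
Definition cder h z (d : C) := forall e : R, 0 < e ->
  exists2 r : R, 0 < r & forall c, nc c <= r ->
    nc (h (z + c) - h z - d * c) <= e * nc c.

Lemma cderP h z d :
  is_derive (z : C^o) (1 : C^o) (h : C^o -> C^o) (d : C^o) <-> cder h z d.
Proof.
rewrite is_derive_epsP; split=> hd e.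
  move=> e0; have [|r /gt0_realC[-> r0] hr] := hd e%:C%C; first by rewrite ltcR.
  exists (complex.Re r) => // c cr; rewrite -lecR rmorphM /= -!normcC; apply: hr.
  by rewrite normcC lecR.
move=> /gt0_realC[-> e0]; have [r r0 hr] := hd _ e0.
exists r%:C%C; first by rewrite ltcR.
by move=> c; rewrite !normcC lecR -rmorphM lecR; exact: hr.
Qed.

Lemma cder_cst a z : cder (fun=> a) z 0.
Proof. by apply/cderP; exact: is_derive_cst. Qed.

Lemma cder_id z : cder id z 1.
Proof. by apply/cderP; exact: is_derive_id. Qed.

Lemma cderD h1 h2 z d1 d2 : cder h1 z d1 -> cder h2 z d2 ->
  cder (fun z => h1 z + h2 z) z (d1 + d2).
Proof. by move=> /cderP ? /cderP ?; apply/cderP; exact: is_deriveD. Qed.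

Lemma cderN h z d : cder h z d -> cder (fun z => - h z) z (- d).
Proof. by move=> /cderP ?; apply/cderP; exact: is_deriveN. Qed.

Lemma cderM h1 h2 z d1 d2 : cder h1 z d1 -> cder h2 z d2 ->
  cder (fun z => h1 z * h2 z) z (h1 z * d2 + h2 z * d1).
Proof. by move=> /cderP ? /cderP ?; apply/cderP; exact: is_deriveM. Qed.

Lemma cder_differentiable h z : (exists d, cder h z d) <->
  differentiable (h : C^o -> C^o) (z : C^o).
Proof.
split=> [[d /cderP[hd _]]|/derivable1_diffP hd]; first exact/derivable1_diffP.
by eexists; apply/cderP; apply: DeriveDef; first exact: hd.
Qed.

Definition entire h := forall z, exists d, cder h z d.

Lemma entireD h1 h2 : entire h1 -> entire h2 -> entire (fun z => h1 z + h2 z).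
Proof.
move=> H1 H2 z; have [d1 D1] := H1 z; have [d2 D2] := H2 z.
by exists (d1 + d2); exact: (cderD D1 D2).
Qed.

Lemma entireM h1 h2 : entire h1 -> entire h2 -> entire (fun z => h1 z * h2 z).
Proof.
move=> H1 H2 z; have [d1 D1] := H1 z; have [d2 D2] := H2 z.
by exists (h1 z * d2 + h2 z * d1); exact: (cderM D1 D2).
Qed.

Lemma entire_cst a : entire (fun=> a).
Proof. by move=> z; exists 0; exact: cder_cst. Qed.

Lemma entire_id : entire id.
Proof. by move=> z; exists 1; exact: cder_id. Qed.

Lemma entire_comp h1 h2 : entire h1 -> entire h2 -> entire (h1 \o h2).
Proof.
move=> H1 H2 z; apply/cder_differentiable.
have /cder_differentiable D2 := H2 z; have /cder_differentiable D1 := H1 (h2 z).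
exact: (@differentiable_comp _ C^o C^o C^o h2 h1 z D2 D1).
Qed.

Definition cexp (w : C) : C :=
  (expR (complex.Re w) * cos (complex.Im w) +i* (expR (complex.Re w) * sin (complex.Im w)))%C.

Lemma cexpD w c : cexp (w + c) = cexp w * cexp c.
Proof.
case: w => a b; case: c => a' b'; rewrite /cexp /=.
apply/eqP; rewrite eq_complex /=; apply/andP; split; apply/eqP.
  by rewrite expRD cosD; ring.
by rewrite expRD sinD; ring.
Qed.

Lemma cexp0 : cexp 0 = 1.
Proof. by rewrite /cexp /= expR0 cos0 sin0 mulr1 mulr0. Qed.

Lemma normc_cexp w : nc (cexp w) = expR (complex.Re w).
Proof.
by rewrite /cexp /= !exprMn -mulrDr cos2Dsin2 mulr1 sqrtr_sqr ger0_norm.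
Qed.

Lemma cexp_cder0 : cder cexp 0 1.
Proof.
(* The errors on the real and imaginary parts add up to 9 * e1 * m below; 16 leaves room. *)
move=> e e0; have [e1 [e10 e11 e1e]] : exists e1 : R, [/\ 0 < e1, e1 <= 1 & e1 * 16 <= e].
  exists (Num.min (e / 16) 1); split.
  - by rewrite lt_min divr_gt0 ?ltr01.
  - by rewrite ge_min lexx orbT.
  - by rewrite -ler_pdivlMr // ge_min lexx.
have [r1 r10 h1] := (is_derive_epsP _ _ _).1 (is_derive_expR (0 : R)) _ e10.
have [r2 r20 h2] := (is_derive_epsP _ _ _).1 (is_derive_cos (0 : R)) _ e10.
have [r3 r30 h3] := (is_derive_epsP _ _ _).1 (is_derive_sin (0 : R)) _ e10.
exists (Num.min (Num.min r1 e1) (Num.min r2 r3)); first by rewrite !lt_min r10 e10 r20 r30.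
case=> a b; rewrite !le_min => /andP[/andP[c1 c2] /andP[c3 c4]].
have ra := Re_le_normc (Complex a b); have rb := Im_le_normc (Complex a b).
rewrite /= -/(nc (Complex a b)) in ra rb.
set m := nc _ in c1 c2 c3 c4 ra rb *.
have {h1} := h1 a (le_trans ra c1); have {h2} := h2 b (le_trans rb c3).
have {h3} := h3 b (le_trans rb c4).
rewrite !add0r expR0 cos0 sin0 oppr0 mul0r !subr0 !mul1r => h3 h2 h1.
apply: le_trans (normc_le_ReIm _) _; rewrite cexp0 /cexp /=.
rewrite subr0; rewrite ?oppr0 addr0 in h3.
set u := expR a in h1 *; set v := cos b in h2 *; set w := sin b in h3 *.
have m0 : 0 <= m by exact: normc_ge0.
have e1a : e1 * `|a| <= e1 * m by rewrite ler_pM2l.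
have e1b : e1 * `|b| <= e1 * m by rewrite ler_pM2l.
have u1 : `|u - 1| <= 2 * m.
  have -> : u - 1 = (u - 1 - a) + a by ring.
  apply: le_trans (ler_normD _ _) _.
  have : e1 * m <= 1 * m by rewrite ler_wpM2r.
  lra.
have u2 : `|u| <= 3.
  have -> : u = (u - 1) + 1 by ring.
  by apply: le_trans (ler_normD _ _) _; rewrite normr1; lra.
have w2 : `|w| <= 2 * m.
  have -> : w = (w - b) + b by ring.
  apply: le_trans (ler_normD _ _) _.
  have : e1 * m <= 1 * m by rewrite ler_wpM2r.
  lra.
have A : `|u * v - 1 - a| <= 4 * (e1 * m).
  have -> : u * v - 1 - a = u * (v - 1) + (u - 1 - a) by ring.
  apply: le_trans (ler_normD _ _) _; rewrite normrM.
  have : `|u| * `|v - 1| <= 3 * (e1 * m).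
    by apply: ler_pM => //; exact: le_trans e1b.
  lra.
have B : `|u * w - b| <= 4 * (e1 * m) + e1 * m.
  have -> : u * w - b = (u - 1) * w + (w - b) by ring.
  apply: le_trans (ler_normD _ _) _; rewrite normrM.
  have : `|u - 1| * `|w| <= (2 * e1) * (2 * m).
    apply: ler_pM => //; apply: le_trans u1 _; lra.
  lra.
have : e1 * 16 * m <= e * m by rewrite ler_wpM2r.
have : 0 <= e1 * m by rewrite mulr_ge0 // ltW.
lra.
Qed.

Lemma cexp_entire : entire cexp.
Proof.
move=> w; exists (cexp w) => e e0.
have k0 : 0 < nc (cexp w) by rewrite normc_cexp expR_gt0.
have [r r0 hr] := cexp_cder0 (divr_gt0 e0 k0).
exists r => // c cr; have := hr c cr; rewrite add0r cexp0 mul1r.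
rewrite mulrAC ler_pdivlMr // => hc; apply: le_trans hc.
rewrite -Normc.normcM cexpD le_eqVlt; apply/orP; left; apply/eqP; congr nc; ring.
Qed.

(** The form is Im (h dz) = Im h dx + Re h dy, closed by the Cauchy-Riemann equations. Its integral
    along a vertical line is that of Re h. *)
Lemma entire_closed_form h : entire h ->
  forall x y, closed_form_at (fun x y => complex.Im (h (Complex x y)))
    (fun x y => complex.Re (h (Complex x y))) x y.
Proof.
move=> H x y; have [d hd] := H (Complex x y).
exists (complex.Im d), (complex.Re d), (- complex.Im d) => e e0.
have [r r0 hr] := hd e e0.
exists (r / 2); first by rewrite divr_gt0.
move=> a b ha hb; set c := Complex a b.
have cab : nc c <= `|a| + `|b| by exact: normc_le_ReIm.
have cr : nc c <= r by apply: le_trans cab _; lra.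
have hc := hr c cr.
have ec : e * nc c <= e * (`|a| + `|b|) by rewrite ler_pM2l.
have -> : Complex (x + a) (y + b) = Complex x y + c by [].
set X := h (Complex x y + c) in hc *; set Y := h (Complex x y) in hc *.
have E1 : complex.Im X - complex.Im Y - complex.Im d * a - complex.Re d * b
   = complex.Im (X - Y - d * c).
  by rewrite /c; case: X Y d {hd hr hc} => [X1 X2] [Y1 Y2] [d1 d2] /=; ring.
have E2 : complex.Re X - complex.Re Y - complex.Re d * a - - complex.Im d * b
   = complex.Re (X - Y - d * c).
  by rewrite /c; case: X Y d {hd hr hc E1} => [X1 X2] [Y1 Y2] [d1 d2] /=; ring.
rewrite E1 E2; split; (apply: le_trans ec; apply: le_trans hc).
  exact: Im_le_normc.
exact: Re_le_normc.
Qed.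

(** The integral of Re h over a vertical period does not depend on the abscissa. It is close to 2 pi
    Re L at [x1], and at [x2] it is controlled by [K]. Vertical lines stand for circles, h for a
    function of exp w, and [L] for its value at the centre. *)
Lemma Re_circle_bound h (L : C) x2 (K : R) : entire h ->
  (forall w, h (w + Complex 0 (pi *+ 2)) = h w) ->
  (forall e, 0 < e -> exists2 x1, x1 <= x2 & forall y, nc (h (Complex x1 y) - L) <= e) ->
  (forall y, nc (h (Complex x2 y)) <= K) -> `|complex.Re L| <= K.
Proof.
move=> H per lim bnd; apply/ler_addgt0Pr => e e0.
have [x1 x12 hx1] := lim e e0.
have T0 : 0 < pi *+ 2 :> R by rewrite pmulrn_lgt0 // pi_gt0.
have perP u : complex.Im (h (Complex u (pi *+ 2))) = complex.Im (h (Complex u 0)).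
  rewrite -(per (Complex u 0)); congr (complex.Im (h _)).
  by apply/eqP; rewrite eq_complex /= addr0 add0r !eqxx.
have [F1 [F2 [d1 d2 e12]]] := goursat_periodic (ltW T0) (entire_closed_form H) perP x12.
(* The mean over a period is attained at some point, so pointwise bounds replace estimates of
   integrals. *)
have mvt (F f : R -> R) : (forall t : R, 0 <= t -> is_derive t 1 F (f t)) ->
    exists c : R, F (pi *+ 2) - F 0 = f c * (pi *+ 2).
  move=> dF; have [||c _ cE] := @MVT_segment _ F f 0 (pi *+ 2) (ltW T0).
  - by move=> x; rewrite in_itv /= => /andP[x0 _]; apply: dF; exact: ltW.
  - apply: derivable_within_continuous => x; rewrite in_itv /= => /andP[x0 _].
    exact: (@ex_derive _ _ _ _ _ _ _ (dF x x0)).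
  - by exists c; rewrite cE subr0.
have [c1 E1] := mvt _ _ d1; have [c2 E2] := mvt _ _ d2.
have /(mulIf (lt0r_neq0 T0)) E : complex.Re (h (Complex x1 c1)) * (pi *+ 2) =
  complex.Re (h (Complex x2 c2)) * (pi *+ 2) by rewrite -E1 -E2.
have b2 := le_trans (Re_le_normc _) (bnd c2).
have b1 := le_trans (Re_le_normc _) (hx1 c1).
have -> : complex.Re L = complex.Re (h (Complex x2 c2)) -
    complex.Re (h (Complex x1 c1) - L).
  by rewrite -E; case: (h _) (L) => [? ?] [? ?] /=; ring.
by apply: le_trans (ler_normB _ _) _; exact: lerD.
Qed.

(** The imaginary part is the real part of - i h; adding the two bounds gives the factor 2. *)
Lemma circle_bound h (L : C) x2 (K : R) : entire h ->
  (forall w, h (w + Complex 0 (pi *+ 2)) = h w) ->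
  (forall e, 0 < e -> exists2 x1, x1 <= x2 & forall y, nc (h (Complex x1 y) - L) <= e) ->
  (forall y, nc (h (Complex x2 y)) <= K) -> nc L <= 2 * K.
Proof.
move=> H per lim bnd; apply: le_trans (normc_le_ReIm _) _.
have b1 := Re_circle_bound H per lim bnd.
have := @Re_circle_bound (fun w => - ('i)%C * h w) (- ('i)%C * L) x2 K.
have -> : complex.Re (- ('i)%C * L) = complex.Im L.
  by case: (L) => ? ? /=; ring.
have ni z : nc (- ('i)%C * z) = nc z by rewrite Normc.normcM normc_opp normc_i mul1r.
move=> b2; have {}b2 : `|complex.Im L| <= K.
  apply: b2.
  - by apply: entireM => //; exact: entire_cst.
  - by move=> w; rewrite per.
  - by move=> e /lim[x1 ? hx]; exists x1 => // y; rewrite -mulrBr ni.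
  - by move=> y; rewrite ni.
by lra.
Qed.

End ComplexDerivative.

(** * Mean value bounds, Cauchy's estimate and limits of polynomials *)

Section Liouville.
Context {R : realType}.
Local Notation C := R[i].
Local Notation nc := (@Normc.normc R).
Implicit Types (h : C -> C) (z w : C).

Lemma cexp_2pi w : cexp (w + Complex 0 (pi *+ 2)) = cexp w.
Proof.
have e1 : cexp (Complex 0 (pi *+ 2)) = 1 :> C.
  by rewrite /cexp /= expR0 !mul1r cos2pi sin2pi.
by rewrite cexpD e1 mulr1.
Qed.

Lemma cexpN_2pi w : cexp (- (w + Complex 0 (pi *+ 2))) = cexp (- w).
Proof. by rewrite -(cexp_2pi (- (w + _))) opprD subrK. Qed.

Lemma cexpNM w : cexp w * cexp (- w) = 1.
Proof. by rewrite -cexpD subrr cexp0. Qed.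

Lemma entire_shift_cexp h z : entire h -> entire (fun w => h (z + cexp w)).
Proof.
move=> H; apply: (entire_comp H); apply: entireD; first exact: entire_cst.
exact: cexp_entire.
Qed.

(** On the line Re w = ln r the point z + exp w runs over the circle of radius r, and it tends to z
    as Re w tends to - infinity. *)
Lemma mean_bound h z (r K : R) : entire h -> 0 < r ->
  (forall c : C, nc c = r -> nc (h (z + c)) <= K) -> nc (h z) <= 2 * K.
Proof.
move=> H r0 bnd; apply: (@circle_bound _ (fun w => h (z + cexp w)) _ (ln r)).
- exact: entire_shift_cexp.
- by move=> w; rewrite cexp_2pi.
- move=> e e0; have [d hd] := H z; have [s s0 hs] := hd 1 ltr01.
  have k0 : 0 < 1 + nc d by rewrite ltr_pwDl // normc_ge0.
  have [x [x1 x2 x3]] : exists x, [/\ x <= ln r, expR x <= s & expR x <= e / (1 + nc d)].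
    exists (Num.min (ln r) (Num.min (ln s) (ln (e / (1 + nc d))))); split.
    - by rewrite ge_min lexx.
    - by rewrite -[leRHS]lnK // ler_expR !ge_min lexx !orbT.
    - by rewrite -[leRHS]lnK ?posrE ?divr_gt0 // ler_expR !ge_min lexx !orbT.
  exists x => // y; set c := cexp _.
  have cx : nc c = expR x by rewrite normc_cexp.
  have := hs c; rewrite cx => /(_ x2); rewrite mul1r => hc.
  rewrite -[_ - _](subrK (d * c)); apply: le_trans (normc_triangle _ _) _.
  rewrite Normc.normcM cx; apply: (@le_trans _ _ ((1 + nc d) * expR x)).
    by rewrite mulrDl mul1r lerD2r.
  by rewrite mulrC -ler_pdivlMr.
- by move=> y; apply: bnd; rewrite normc_cexp /= lnK.
Qed.

(** The same argument for the difference quotient (h (z + c) - h z) / c with c = exp w, whose limit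
    is [d]. On the circle it is at most (K + 2 K) / r by [mean_bound], and [circle_bound] doubles
    this to 6 K / r. *)
Lemma cauchy_bound h z d (r K : R) : entire h -> cder h z d -> 0 < r ->
  (forall c : C, nc c = r -> nc (h (z + c)) <= K) -> nc d <= 6 * K / r.
Proof.
move=> H hd r0 bnd.
have -> : 6 * K / r = 2 * ((K + 2 * K) / r) by field; exact: lt0r_neq0.
apply: (@circle_bound _ (fun w => (h (z + cexp w) - h z) * cexp (- w)) _ (ln r)).
- apply: entireM.
    by apply: entireD; [exact: entire_shift_cexp | exact: entire_cst].
  apply: (entire_comp (@cexp_entire R)) => w.
  by exists (- 1); apply: cderN; exact: cder_id.
- by move=> w; rewrite cexp_2pi cexpN_2pi.
- move=> e e0; have [s s0 hs] := hd e e0.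
  exists (Num.min (ln r) (ln s)); first by rewrite ge_min lexx.
  move=> y; set w := Complex _ y; set c := cexp w.
  have cs : nc c <= s.
    by rewrite normc_cexp /= -[leRHS]lnK // ler_expR !ge_min lexx !orbT.
  have -> : (h (z + c) - h z) * cexp (- w) - d =
     (h (z + c) - h z - d * c) * cexp (- w).
    by rewrite [RHS]mulrBl -mulrA cexpNM mulr1.
  rewrite Normc.normcM; apply: (@le_trans _ _ (e * nc c * nc (cexp (- w)))).
    by rewrite ler_wpM2r ?normc_ge0 // hs.
  by rewrite -mulrA -Normc.normcM cexpNM Normc.normc1 mulr1.
- move=> y; rewrite Normc.normcM (normc_cexp (- _)) /= expRN lnK ?posrE //.
  rewrite ler_pM2r ?invr_gt0 //; apply: le_trans (normc_triangle _ _) _.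
  rewrite normc_opp; apply: lerD; last exact: (mean_bound H r0 bnd).
  by apply: bnd; rewrite normc_cexp /= lnK.
Qed.

(** The mean value theorem fails for complex values; it holds for the real part along a segment, and
    for the imaginary part, up to another intermediate point, through - i h. *)
Lemma Re_mvt h (D : C -> C) z c : (forall z, cder h z (D z)) ->
  exists2 t : R, 0 <= t <= 1 &
    complex.Re (h (z + c) - h z) = complex.Re (D (z + t%:C%C * c) * c).
Proof.
move=> hD; pose k (t : R) := complex.Re (h (z + t%:C%C * c)).
have ReE (X Y d u : C) (s : R) :
    complex.Re X - complex.Re Y - complex.Re (d * u) * s =
    complex.Re (X - Y - d * (s%:C%C * u)).
  by case: X Y d u => [? ?] [? ?] [? ?] [? ?] /=; ring.
have dk (t : R) : is_derive (t : R^o) (1 : R^o) (k : R^o -> R^o)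
    (complex.Re (D (z + t%:C%C * c) * c)).
  apply/is_derive_epsP => e e0; set d := D _.
  have k0 : 0 < 1 + nc c by rewrite ltr_pwDl // normc_ge0.
  have [r r0 hr] := hD (z + t%:C%C * c) _ (divr_gt0 e0 k0).
  exists (r / (1 + nc c)); first exact: divr_gt0.
  move=> s hs; have ns : nc (s%:C%C * c) = `|s| * nc c by rewrite Normc.normcM normc_real.
  have sr : nc (s%:C%C * c) <= r.
    rewrite ns; apply: (@le_trans _ _ (`|s| * (1 + nc c))).
      by rewrite ler_wpM2l // lerDr.
    by rewrite -ler_pdivlMr.
  have := hr _ sr; rewrite ns -/d => h1.
  have -> : k (t + s) - k t - complex.Re (d * c) * s =
    complex.Re (h (z + t%:C%C * c + s%:C%C * c) - h (z + t%:C%C * c) - d * (s%:C%C * c)).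
    rewrite /k rmorphD /= mulrDl addrA.
    exact: ReE.
  apply: le_trans (Re_le_normc _) _; apply: le_trans h1 _.
  rewrite mulrAC ler_pdivrMr //.
  rewrite -mulrA ler_pM2l //.
  by rewrite ler_wpM2l // lerDr.
have kc : {within `[(0 : R), 1], continuous k}.
  apply: derivable_within_continuous => x _.
  exact: (@ex_derive _ _ _ _ _ _ _ (dk x)).
have [t tI kE] := @MVT_segment R k _ 0 1 (@ler01 R) (fun x _ => dk x) kc.
rewrite in_itv /= in tI; rewrite subr0 mulr1 in kE; exists t => //.
rewrite -kE /k mul0r addr0 mul1r.
by case: (h _) (h _) => [? ?] [? ?].
Qed.

Lemma normc_mvt h (D : C -> C) z c K : (forall z, cder h z (D z)) ->
  (forall t : R, 0 <= t <= 1 -> nc (D (z + t%:C%C * c)) <= K) ->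
  nc (h (z + c) - h z) <= 2 * K * nc c.
Proof.
move=> hD bnd; apply: le_trans (normc_le_ReIm _) _.
have [t t01 ->] := Re_mvt z c hD.
have hD' : forall z, cder (fun z => - ('i)%C * h z) z (- ('i)%C * D z + h z * 0).
  by move=> u; apply: cderM => //; exact: cder_cst.
have [t' t01' E] := Re_mvt z c hD'.
have -> : complex.Im (h (z + c) - h z) = complex.Re (- 'i%C * h (z + c) - - 'i%C * h z).
  by case: (h _) (h _) => [? ?] [? ?] /=; ring.
rewrite E mulr0 addr0.
have -> : 2 * K * nc c = K * nc c + K * nc c by ring.
apply: lerD; apply: le_trans (Re_le_normc _) _; rewrite !Normc.normcM ?normc_opp ?normc_i ?mul1r.
  by rewrite ler_wpM2r ?normc_ge0 // bnd.
by rewrite ler_wpM2r ?normc_ge0 // bnd.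
Qed.

(** A polynomial of degree at most n is given by its values at 0, ..., n through Lagrange
    interpolation, and so the limit is the interpolation polynomial of the limit values. *)
Lemma poly_pointwise_limit (n : nat) (f_ : nat -> {poly C}) (D : C -> C) :
  (forall m, (size (f_ m) <= n.+1)%N) ->
  (forall z (e : R), 0 < e -> exists N, forall m, (N <= m)%N -> nc ((f_ m).[z] - D z) <= e) ->
  exists2 p : {poly C}, (size p <= n.+1)%N & forall z, D z = p.[z].
Proof.
move=> sf lim.
pose x (i : nat) : C := i%:R.
have x_inj : injective x by move=> i j /eqP; rewrite eqr_nat => /eqP.
pose l i : {poly C} := tnth (lagrange n.+1 x) i.
have gen (q : {poly C}) : (size q <= n.+1)%N -> q = \sum_(i < n.+1) (q.[x i])%:P * l i.
  by move=> sq; rewrite {1}(lagrange_gen (isT : (0 < n.+1)%N) x_inj sq).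
exists (\sum_(i < n.+1) (D (x i))%:P * l i).
  apply: (leq_trans (size_sum _ _ _)); apply/bigmax_leqP => i _.
  rewrite mul_polyC; apply: leq_trans (size_scale_leq _ _) _.
  by rewrite size_lagrange_.
move=> z; apply/eqP; rewrite -subr_eq0; apply/eqP/Normc.eq0_normc.
apply/eqP; rewrite eq_le normc_ge0 andbT.
pose S := \sum_(i < n.+1) nc (l i).[z].
have S0 : 0 <= S by apply: sumr_ge0 => i _; exact: normc_ge0.
have S1 : 0 < 1 + S by rewrite ltr_pwDl.
apply/ler_addgt0Pr => e e0; rewrite add0r.
(* An error e / (1 + S) at [z] and at each node adds up to at most e, since [S] sums the moduli of
   the Lagrange polynomials at [z]. *)
have e1 : 0 < e / (1 + S) by exact: divr_gt0.
have [N0 hN0] := lim z _ e1.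
have /choice[N_ hN] : forall i : 'I_n.+1, exists N, forall m, (N <= m)%N ->
   nc ((f_ m).[x i] - D (x i)) <= e / (1 + S) by move=> i; exact: lim.
pose m := maxn N0 (\max_i N_ i).
have hm := hN0 m (leq_maxl _ _).
have hmi (i : 'I_n.+1) : nc ((f_ m).[x i] - D (x i)) <= e / (1 + S).
  by apply: hN; apply: leq_trans (leq_maxr _ _); exact: leq_bigmax.
have nc_sum (I : finType) (F : I -> C) : nc (\sum_i F i) <= \sum_i nc (F i).
  elim/big_ind2: _ => [|a b u v h1 h2|//]; first by rewrite Normc.normc0.
  by apply: le_trans (normc_triangle _ _) _; exact: lerD.
have E : D z - (\sum_(i < n.+1) (D (x i))%:P * l i).[z] =
   - ((f_ m).[z] - D z) + \sum_(i < n.+1) ((f_ m).[x i] - D (x i)) * (l i).[z].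
  have -> : \sum_(i < n.+1) ((f_ m).[x i] - D (x i)) * (l i).[z] =
    (f_ m).[z] - (\sum_(i < n.+1) (D (x i))%:P * l i).[z].
    rewrite [in RHS](gen (f_ m) (sf m)) !horner_sum -sumrB; apply: eq_bigr => i _.
    by rewrite !hornerM !hornerC mulrBl.
  by rewrite opprB [D z - _]addrC addrACA addrA [in RHS]addrAC; ring.
rewrite E; apply: le_trans (normc_triangle _ _) _; rewrite normc_opp.
have -> : e = e / (1 + S) + e / (1 + S) * S.
  by rewrite -[X in X + _]mulr1 -mulrDr divfK // lt0r_neq0.
apply: lerD => //; apply: le_trans (nc_sum _ _) _.
rewrite /S mulr_sumr; apply: ler_sum => i _; rewrite Normc.normcM.
by rewrite ler_wpM2r ?normc_ge0.
Qed.

End Liouville.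

(** * Entire functions of polynomial growth *)

Section EntirePolynomial.
Context {R : realType}.
Local Notation C := R[i].
Local Notation nc := (@Normc.normc R).
Implicit Types (h : C -> C) (z w : C) (p q : {poly C}).

Lemma cder_horner p z : cder (fun z => p.[z]) z p^`().[z].
Proof.
elim/poly_ind: p => [|p c IH].
  rewrite deriv0 horner0.
  have -> : (fun z => (0 : {poly C}).[z]) = fun=> 0 by apply/funext => u; rewrite horner0.
  exact: cder_cst.
have -> : (fun z => (p * 'X + c%:P).[z]) = fun z => p.[z] * z + c.
  by apply/funext => u; rewrite hornerMXaddC.
have -> : (p * 'X + c%:P)^`().[z] = p.[z] * 1 + z * p^`().[z] + 0.
  rewrite derivD poly.derivC derivM derivX !hornerE addrC; congr (_ + _).
  by rewrite mulrC.
apply: cderD; last exact: cder_cst.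
by apply: cderM => //; exact: cder_id.
Qed.

Lemma poly_primitive p : exists2 q : {poly C}, (size q <= (size p).+1)%N & q^`() = p.
Proof.
exists (\poly_(i < (size p).+1) (p`_i.-1 / i%:R)); first exact: size_poly.
apply/polyP => i; rewrite coef_deriv coef_poly ltnS.
case: ltnP => hi; last by rewrite mul0rn nth_default.
by rewrite -[LHS]mulr_natr divfK // pnatr_eq0.
Qed.

Lemma entire_der0_cst h : (forall z, cder h z 0) -> forall z, h z = h 0.
Proof.
move=> h0 z; have := @normc_mvt _ h (fun=> 0) 0 z 0 h0.
rewrite mulr0 mul0r add0r => /(_ _) hz; apply/eqP; rewrite -subr_eq0.
apply/eqP/Normc.eq0_normc/eqP; rewrite eq_le normc_ge0 andbT; apply: hz.
by move=> t _; rewrite Normc.normc0.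
Qed.

(* The difference quotients of h are entire of growth n - 1 by Cauchy's estimate,
   hence polynomials of degree < n by induction, and so is their limit h'. *)
Lemma entire_polynomial (n : nat) h (M : R) : entire h -> 0 <= M ->
  (forall z, nc (h z) <= M * (1 + nc z) ^+ n) ->
  exists2 p : {poly C}, (size p <= n.+1)%N & forall z, h z = p.[z].
Proof.
elim: n h M => [|n IH] h M H M0 bnd; have [D hD] := choice H.
- have D0 z : D z = 0.
    apply/Normc.eq0_normc/eqP; rewrite eq_le normc_ge0 andbT.
    apply/ler_addgt0Pr => e e0; rewrite add0r.
    (* On this radius Cauchy's estimate is at most e; the + 1 keeps the radius positive when M =
       0. *)
    have r0 : 0 < (6 * M + 1) / e by rewrite divr_gt0 //; lra.
    have := @cauchy_bound _ h z (D z) _ M H (hD z) r0 _.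
    have {}bnd c : nc c = (6 * M + 1) / e -> nc (h (z + c)) <= M.
      by move=> _; have := bnd (z + c); rewrite expr0 mulr1.
    move=> /(_ bnd) /le_trans; apply.
    rewrite invf_div mulrA ler_pdivrMr; last by lra.
    by rewrite mulrC ler_wpM2l // ltW //; lra.
  exists (h 0)%:P; first exact: size_polyC_leq1.
  by move=> z; rewrite hornerC; apply: entire_der0_cst => u; rewrite -(D0 u).
(* Cauchy's estimate on the circle of radius 1 + |z|, on which 1 + |z + c| <= 2 (1 + |z|). *)
- pose M1 := 6 * M * 2 ^+ n.+1.
  have M10 : 0 <= M1 by rewrite !mulr_ge0 // exprn_ge0.
  have bD z : nc (D z) <= M1 * (1 + nc z) ^+ n.
    have r0 : 0 < 1 + nc z by rewrite ltr_pwDl // normc_ge0.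
    have := @cauchy_bound _ h z (D z) _ (M * (2 * (1 + nc z)) ^+ n.+1) H (hD z) r0 _.
    have bc c : nc c = 1 + nc z -> nc (h (z + c)) <= M * (2 * (1 + nc z)) ^+ n.+1.
      move=> hc; apply: le_trans (bnd _) _; rewrite ler_wpM2l //.
      rewrite lerXn2r ?nnegrE ?addr_ge0 ?mulr_ge0 ?normc_ge0 //.
        by rewrite addr_ge0 // normc_ge0.
      have := normc_triangle z c; rewrite hc; lra.
    move=> /(_ bc) /le_trans; apply.
    rewrite ler_pdivrMr // /M1 exprMn [(1 + nc z) ^+ n.+1]exprSr.
    by rewrite le_eqVlt; apply/orP; left; apply/eqP; ring.
  (* [D] is not known to be differentiable, so the induction hypothesis goes to the quotients. Their
     steps are at most 1, which makes the growth bound [M2] uniform in m. *)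
  pose Dq (m : nat) z := m.+1%:R * (h (z + m.+1%:R^-1) - h z).
  have nm (m : nat) : nc (m.+1%:R : C) = m.+1%:R.
    by rewrite normcMn Normc.normc1.
  have nmV (m : nat) : nc (m.+1%:R^-1 : C) = m.+1%:R^-1.
    by rewrite Normc.normcV nm.
  have nmV1 (m : nat) : nc (m.+1%:R^-1 : C) <= 1.
    by rewrite nmV invf_le1 ?ler1n ?ltr0n.
  pose M2 := 2 * (M1 * 2 ^+ n).
  have bq m z : nc (Dq m z) <= M2 * (1 + nc z) ^+ n.
    rewrite /Dq Normc.normcM nm.
    have hm := @normc_mvt _ h D z (m.+1%:R^-1) (M1 * (2 * (1 + nc z)) ^+ n) hD _.
    apply: (@le_trans _ _ (m.+1%:R * (2 * (M1 * (2 * (1 + nc z)) ^+ n) * m.+1%:R^-1))).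
      rewrite ler_wpM2l ?ler0n // -nmV; apply: hm => t /andP[t0 t1].
      apply: le_trans (bD _) _; rewrite ler_wpM2l //.
      rewrite lerXn2r ?nnegrE ?addr_ge0 ?mulr_ge0 ?normc_ge0 //.
        by rewrite addr_ge0 // normc_ge0.
      have := normc_triangle z (t%:C%C / m.+1%:R).
      rewrite Normc.normcM normc_real ger0_norm //.
      have : t * nc (m.+1%:R^-1) <= 1 * 1 by apply: ler_pM => //; exact: normc_ge0.
      by have := normc_ge0 z; lra.
    rewrite mulrCA mulfV ?pnatr_eq0 // mulr1 /M2 exprMn.
    by rewrite !mulrA.
  have M20 : 0 <= M2 by rewrite !mulr_ge0 // exprn_ge0.
  have eq_ m : entire (Dq m).
    apply: entireM; first exact: entire_cst.
    apply: entireD.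
      by apply: (entire_comp H); apply: entireD; [exact: entire_id|exact: entire_cst].
    by move=> z; exists (- D z); exact: cderN.
  have /choice[f_ hf] : forall m, exists p : {poly C},
      (size p <= n.+1)%N /\ forall z, Dq m z = p.[z].
    by move=> m; have [p ? ?] := IH _ _ (eq_ m) M20 (bq m); exists p.
  have [p sp Dp] : exists2 p : {poly C}, (size p <= n.+1)%N & forall z, D z = p.[z].
    apply: (@poly_pointwise_limit _ n f_); first by move=> m; have [] := hf m.
    move=> z e e0; have [r r0 hr] := hD z e e0.
    exists (Num.bound r^-1) => m hm; rewrite -(hf m).2 /Dq.
    have := hr (m.+1%:R^-1).
    have -> : nc (m.+1%:R^-1 : C) <= r.
      rewrite nmV -[leRHS]invrK lef_pV2 ?posrE ?invr_gt0 ?ltr0n //.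
      apply: ltW; apply: lt_le_trans (archi_boundP _) _; first by rewrite invr_ge0 ltW.
      by rewrite ler_nat (leq_trans hm).
    move=> /(_ isT); rewrite nmV ler_pdivlMr ?ltr0n // => h1.
    apply: le_trans h1; rewrite -nm -Normc.normcM.
    rewrite le_eqVlt; apply/orP; left; apply/eqP; congr nc.
    by rewrite mulrBl -mulrA mulVf ?pnatr_eq0 // mulr1 mulrC.
  have [q sq qp] := poly_primitive p.
  exists (q + (h 0 - q.[0])%:P).
    apply: leq_trans (size_polyD _ _) _; rewrite geq_max (leq_trans sq) //=.
    exact: leq_trans (size_polyC_leq1 _) _.
  move=> z; rewrite hornerD hornerC.
  have := @entire_der0_cst (fun z => h z + - q.[z]).
  have d0 u : cder (fun z => h z + - q.[z]) u 0.
    have -> : 0 = D u + - q^`().[u] by rewrite qp Dp subrr.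
    by apply: cderD => //; apply: cderN; exact: cder_horner.
  by move=> /(_ d0 z) <-; rewrite addrC subrK.
Qed.

(* The mean value bound controls h on a disc by its values near infinity. *)
Lemma entire_growth_at_infty (n : nat) h (A K : R) : entire h -> 0 < A -> 0 <= K ->
  (forall z, A <= nc z -> nc (h z) <= K * nc z ^+ n) ->
  exists2 M, 0 <= M & forall z, nc (h z) <= M * (1 + nc z) ^+ n.
Proof.
move=> H A0 K0 hK.
pose M := K + 2 * (K * (3 * A) ^+ n).
have KA0 : 0 <= K * (3 * A) ^+ n.
  by rewrite mulr_ge0 // exprn_ge0 // mulr_ge0 // ltW.
exists M; first by rewrite addr_ge0 // mulr_ge0.
move=> z; have z0 := normc_ge0 z; have [zA|/ltW zA] := leP A (nc z).
  apply: le_trans (hK z zA) _; apply: ler_pM => //.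
  - by rewrite exprn_ge0.
  - by rewrite lerDl mulr_ge0.
  - by rewrite lerXn2r ?nnegrE ?addr_ge0 // lerDr.
have : nc (h z) <= 2 * (K * (3 * A) ^+ n).
  (* For |z| <= A the circle of radius 2 A around z lies between the radii A and 3 A. *)
  apply: (@mean_bound _ h z (2 * A)) => //; first by rewrite mulr_gt0.
  move=> c hc.
  have h1 : A <= nc (z + c).
    have := normc_triangle (z + c) (- z); rewrite normc_opp addrAC subrr add0r hc; lra.
  have h2 : nc (z + c) <= 3 * A by have := normc_triangle z c; rewrite hc; lra.
  apply: le_trans (hK _ h1) _; rewrite ler_wpM2l // lerXn2r ?nnegrE ?normc_ge0 //.
  by rewrite mulr_ge0 // ltW.
move=> /le_trans; apply.
have e1 : 1 <= (1 + nc z) ^+ n by rewrite exprn_ege1 // lerDl.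
by rewrite -[leLHS]mulr1; apply: ler_pM => //; [rewrite mulr_ge0 | rewrite /M lerDr].
Qed.

(** Boundedness of g near 0 is growth of degree n of h at infinity, so h is a polynomial; C is
    algebraically closed, and without a root its size is 1. *)
Lemma nonvanishing_section_constant (n : nat) h (g : C -> C) :
  entire h -> entire g -> (forall z, z != 0 -> h z = z ^+ n * g z^-1) ->
  (forall z, h z != 0) -> exists2 c, c != 0 & forall z, h z = c.
Proof.
move=> H G hg h0.
have [d hd] := G 0; have [r r0 hr] := hd 1 ltr01.
pose K := nc (g 0) + (1 + nc d) * r.
have K0 : 0 <= K by rewrite addr_ge0 ?normc_ge0 // mulr_ge0 ?addr_ge0 ?normc_ge0 // ltW.
have gK c : nc c <= r -> nc (g c) <= K.
  move=> cr; have := hr c cr; rewrite add0r mul1r => h1.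
  have -> : g c = (g c - g 0 - d * c) + d * c + g 0 by ring.
  apply: le_trans (normc_triangle _ _) _; rewrite /K addrC lerD2l.
  apply: le_trans (normc_triangle _ _) _; rewrite Normc.normcM mulrDl mul1r.
  apply: lerD; first exact: le_trans cr.
  by rewrite ler_wpM2l ?normc_ge0.
have [] := @entire_growth_at_infty n h r^-1 K H _ K0.
- by rewrite invr_gt0.
- move=> z zr; have z0 : 0 < nc z by apply: lt_le_trans zr; rewrite invr_gt0.
  have zn0 : z != 0 by apply: contraTneq z0 => ->; rewrite Normc.normc0 ltxx.
  rewrite hg // Normc.normcM mulrC.
  have -> : nc (z ^+ n) = nc z ^+ n.
    by elim: n {hg} => [|k IHk]; rewrite ?expr0 ?Normc.normc1 // !exprS Normc.normcM IHk.
  rewrite ler_wpM2r ?exprn_ge0 ?normc_ge0 // gK // Normc.normcV.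
  by rewrite -[leRHS]invrK lef_pV2 ?posrE ?invr_gt0.
move=> M M0 hM; have [p _ hp] := entire_polynomial H M0 hM.
have sp : size p == 1%N.
  apply/negP => /negP /closed_rootP[x]; rewrite rootE -hp => /eqP hx.
  by have := h0 x; rewrite hx eqxx.
have [c c0 pc] := size_poly1P _ sp.
by exists c => // z; rewrite hp pc hornerC.
Qed.

End EntirePolynomial.

(** * Derivatives of complex valued curves *)

Section CurveDerivatives.
Context {R : realType}.
Local Notation C := R[i].
Implicit Types (f g : R -> C) (t : R) (d : C).

Definition curve_derive f t d :=
  is_derive t (1 : R) (fun u => complex.Re (f u)) (complex.Re d) /\
  is_derive t (1 : R) (fun u => complex.Im (f u)) (complex.Im d).

Lemma curve_derive_cst d t : curve_derive (fun=> d) t 0.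
Proof. by split; exact: is_derive_cst. Qed.

Lemma curve_deriveD f g t d e : curve_derive f t d -> curve_derive g t e ->
  curve_derive (fun u => f u + g u) t (d + e).
Proof.
move=> [f1 f2] [g1 g2]; split.
  have -> : (fun u => complex.Re (f u + g u)) = (fun u => complex.Re (f u) + complex.Re (g u)).
    by apply/funext => u; rewrite raddfD.
  by rewrite raddfD; exact: is_deriveD.
have -> : (fun u => complex.Im (f u + g u)) = (fun u => complex.Im (f u) + complex.Im (g u)).
  by apply/funext => u; rewrite raddfD.
by rewrite raddfD; exact: is_deriveD.
Qed.

Lemma curve_deriveM f g t d e : curve_derive f t d -> curve_derive g t e ->
  curve_derive (fun u => f u * g u) t (d * g t + f t * e).
Proof.
move=> [f1 f2] [g1 g2]; split.
  have -> : (fun u => complex.Re (f u * g u)) =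
      (fun u => complex.Re (f u) * complex.Re (g u) - complex.Im (f u) * complex.Im (g u)).
    by apply/funext => u; case: (f u) (g u) => [? ?] [? ?].
  apply: (is_derive_eq (is_deriveB (is_deriveM f1 g1) (is_deriveM f2 g2))).
  by case: (f t) (g t) (d) (e) => [? ?] [? ?] [? ?] [? ?]; rewrite /GRing.scale /=; ring.
have -> : (fun u => complex.Im (f u * g u)) =
    (fun u => complex.Re (f u) * complex.Im (g u) + complex.Im (f u) * complex.Re (g u)).
  by apply/funext => u; case: (f u) (g u) => [? ?] [? ?].
apply: (is_derive_eq (is_deriveD (is_deriveM f1 g2) (is_deriveM f2 g1))).
by case: (f t) (g t) (d) (e) => [? ?] [? ?] [? ?] [? ?]; rewrite /GRing.scale /=; ring.
Qed.

Lemma curve_deriveV f t d : f t != 0 -> curve_derive f t d ->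
  curve_derive (fun u => (f u)^-1) t (- d * (f t)^-1 * (f t)^-1).
Proof.
move=> ft0 [f1 f2].
pose N u := complex.Re (f u) * complex.Re (f u) + complex.Im (f u) * complex.Im (f u).
have N0 : N t != 0.
  rewrite /N -!expr2 paddr_eq0 ?sqr_ge0 // !sqrf_eq0.
  by apply: contra ft0; rewrite eq_complex.
have dN := is_deriveD (is_deriveM f1 f1) (is_deriveM f2 f2).
have dV := @is_deriveV _ N t _ _ N0 dN.
split.
  have -> : (fun u => complex.Re (f u)^-1) = (fun u => complex.Re (f u) * (N u)^-1).
    by apply/funext => u; rewrite /N; case: (f u) => ? ? /=; rewrite -!expr2.
  apply: (is_derive_eq (is_deriveM f1 dV)).
  move: N0; rewrite /N; case: (f t) (d) => [a b] [? ?]; rewrite /GRing.scale /= => N0.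
  by field; rewrite !expr2.
have -> : (fun u => complex.Im (f u)^-1) = (fun u => - complex.Im (f u) * (N u)^-1).
  by apply/funext => u; rewrite /N; case: (f u) => ? ? /=; rewrite -!expr2 mulNr.
have f2N : is_derive t (1 : R) (fun u => - complex.Im (f u)) (- complex.Im d).
  exact: is_deriveN.
apply: (is_derive_eq (is_deriveM f2N dV)).
move: N0; rewrite /N; case: (f t) (d) => [a b] [? ?]; rewrite /GRing.scale /= => N0.
by field; rewrite !expr2.
Qed.

Lemma derivC1 f t d : curve_derive f t d -> derivC 1 f t = d.
Proof.
move=> [[_ a1] [_ a2]]; rewrite /derivC /derive1n /= !derive1E a1 a2.
by case: (d).
Qed.

Lemma derivC_curve_derive f t : (exists d, curve_derive f t d) -> curve_derive f t (derivC 1 f t).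
Proof. by move=> [d fd]; rewrite (derivC1 fd). Qed.

Lemma curve_deriveP f t : (exists d, curve_derive f t d) <->
  derivable (fun u => complex.Re (f u)) t 1 /\ derivable (fun u => complex.Im (f u)) t 1.
Proof.
split=> [[d [[? _] [? _]]] //|[h1 h2]].
exists (Complex ('D_1 (fun u => complex.Re (f u)) t) ('D_1 (fun u => complex.Im (f u)) t)).
by split; [exact: (DeriveDef h1 erefl) | exact: (DeriveDef h2 erefl)].
Qed.

Lemma derivCS nu f : derivC nu.+1 f = derivC nu (derivC 1 f).
Proof. by apply/funext => t; rewrite /derivC /derive1n !iterSr. Qed.

Lemma derivC0 f : derivC 0 f = f.
Proof. by apply/funext => t; rewrite /derivC /=; case: (f t). Qed.

Lemma derivC_all (F : nat -> R -> C) : (forall nu t, curve_derive (F nu) t (F nu.+1 t)) ->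
  forall nu, derivC nu (F 0%N) = F nu.
Proof.
move=> hF nu; elim: nu F hF => [|nu IH] F hF; first by rewrite derivC0.
rewrite derivCS.
have -> : derivC 1 (F 0%N) = F 1%N by apply/funext => t; exact: derivC1.
exact: (IH (fun k => F k.+1)).
Qed.

Section OnOpenSet.
Variable U : set R.
Hypothesis openU : open U.

(** Level [k] asks for k + 1 derivatives on [U]: the derivative of order k is itself still
    differentiable. *)
Fixpoint smooth_on (k : nat) f : Prop :=
  (forall t, U t -> exists d, curve_derive f t d) /\
  (if k is k'.+1 then smooth_on k' (derivC 1 f) else True).

Lemma smooth_on_cderiv k f t : smooth_on k f -> U t -> curve_derive f t (derivC 1 f t).
Proof. by case: k => [|k] [h _] Ut; apply: derivC_curve_derive; exact: h. Qed.

Lemma smooth_onW k f : smooth_on k.+1 f -> smooth_on k f.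
Proof.
elim: k f => [|k IH] f [h1 h2]; split => //; exact: IH.
Qed.

Lemma curve_derive_eq_on f g t d : {in U, f =1 g} -> U t ->
  curve_derive f t d -> curve_derive g t d.
Proof.
move=> fg Ut [f1 f2].
have nU : \forall u \near t, U u by exact: open_nbhs_nbhs.
split.
  apply: near_eq_is_derive f1.
  by apply: filterS nU => u Uu; rewrite fg // inE.
apply: near_eq_is_derive f2.
by apply: filterS nU => u Uu; rewrite fg // inE.
Qed.

Lemma smooth_on_eq k f g : {in U, f =1 g} -> smooth_on k f -> smooth_on k g.
Proof.
elim: k f g => [|k IH] f g fg [h1 h2]; split => //.
- by move=> t Ut; have [d hd] := h1 t Ut; exists d; exact: curve_derive_eq_on hd.
- by move=> t Ut; have [d hd] := h1 t Ut; exists d; exact: curve_derive_eq_on hd.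
- apply: IH h2 => t /set_mem Ut; have [d hd] := h1 t Ut.
  by rewrite (derivC1 hd) (derivC1 (curve_derive_eq_on fg Ut hd)).
Qed.

Lemma derivC_eq_on nu f g : {in U, f =1 g} -> smooth_on nu f ->
  {in U, derivC nu f =1 derivC nu g}.
Proof.
elim: nu f g => [|nu IH] f g fg; first by rewrite !derivC0.
move=> [h1 h2] t Ut; rewrite (derivCS nu f) (derivCS nu g); apply: IH => // u /set_mem Uu.
by have [d hd] := h1 u Uu; rewrite (derivC1 hd) (derivC1 (curve_derive_eq_on fg Uu hd)).
Qed.

Lemma smooth_on_cst k (c : C) : smooth_on k (fun=> c).
Proof.
elim: k c => [|k IH] c; split => //; try by move=> t _; exists 0; exact: curve_derive_cst.
have -> : derivC 1 (fun=> c) = fun=> 0.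
  by apply/funext => t; apply: derivC1; exact: curve_derive_cst.
exact: IH.
Qed.

Lemma smooth_onD k f g : smooth_on k f -> smooth_on k g -> smooth_on k (fun t => f t + g t).
Proof.
elim: k f g => [|k IH] f g [f1 f2] [g1 g2]; split => //.
- move=> t Ut; have [d hd] := f1 t Ut; have [e he] := g1 t Ut.
  by exists (d + e); exact: curve_deriveD.
- move=> t Ut; have [d hd] := f1 t Ut; have [e he] := g1 t Ut.
  by exists (d + e); exact: curve_deriveD.
- apply: smooth_on_eq (IH _ _ f2 g2) => t /set_mem Ut.
  have [d hd] := f1 t Ut; have [e he] := g1 t Ut.
  by rewrite (derivC1 hd) (derivC1 he) (derivC1 (curve_deriveD hd he)).
Qed.

Lemma smooth_onM k f g : smooth_on k f -> smooth_on k g -> smooth_on k (fun t => f t * g t).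
Proof.
elim: k f g => [|k IH] f g sf sg.
  split => // t Ut; have [[d hd] [e he]] := (sf.1 t Ut, sg.1 t Ut).
  by exists (d * g t + f t * e); exact: curve_deriveM.
split => [t Ut|].
  have [[d hd] [e he]] := (sf.1 t Ut, sg.1 t Ut).
  by exists (d * g t + f t * e); exact: curve_deriveM.
apply: (@smooth_on_eq _ (fun t => derivC 1 f t * g t + f t * derivC 1 g t)).
  move=> t /set_mem Ut.
  by rewrite (derivC1 (curve_deriveM (smooth_on_cderiv sf Ut) (smooth_on_cderiv sg Ut))).
apply: smooth_onD; apply: IH.
- exact: sf.2.
- exact: smooth_onW.
- exact: smooth_onW.
- exact: sg.2.
Qed.

Lemma smooth_onV k f : (forall t, U t -> f t != 0) -> smooth_on k f ->
  smooth_on k (fun t => (f t)^-1).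
Proof.
move=> f0; elim: k => [|k IH] sf.
  split => // t Ut; have [d hd] := sf.1 t Ut.
  by exists (- d * (f t)^-1 * (f t)^-1); apply: curve_deriveV => //; exact: f0.
have sV := IH (smooth_onW sf).
split => [t Ut|].
  have [d hd] := sf.1 t Ut.
  by exists (- d * (f t)^-1 * (f t)^-1); apply: curve_deriveV => //; exact: f0.
have sN : smooth_on k (fun t => - derivC 1 f t).
  apply: (@smooth_on_eq _ (fun t => -1 * derivC 1 f t)); first by move=> t _; rewrite mulN1r.
  apply: smooth_onM; last exact: sf.2.
  exact: smooth_on_cst.
apply: smooth_on_eq (smooth_onM (smooth_onM sN sV) sV) => t /set_mem Ut.
by rewrite (derivC1 (curve_deriveV (f0 t Ut) (smooth_on_cderiv sf Ut))).
Qed.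

Definition taylor nu f t : C := derivC nu f t / nu`!%:R.

Lemma taylorS nu f t : taylor nu (derivC 1 f) t = nu.+1%:R * taylor nu.+1 f t.
Proof.
by rewrite /taylor -(derivCS nu) factS natrM invfM mulrCA mulVKf ?pnatr_eq0.
Qed.

Lemma derivCD nu f g t : smooth_on nu f -> smooth_on nu g -> U t ->
  derivC nu (fun t => f t + g t) t = derivC nu f t + derivC nu g t.
Proof.
elim: nu f g => [|nu IH] f g sf sg Ut; first by rewrite !derivC0.
rewrite (derivCS nu f) (derivCS nu g) (derivCS nu (fun t => _)) -IH //; [|exact: sf.2|exact: sg.2].
apply: derivC_eq_on; last by rewrite inE.
  move=> u /set_mem Uu.
  by rewrite (derivC1 (curve_deriveD (smooth_on_cderiv sf Uu) (smooth_on_cderiv sg Uu))).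
exact: (smooth_onD sf sg).2.
Qed.

(* (nu+1) T_(nu+1)(fg) = T_nu(f'g + fg') and (i+1) T_(i+1)(f) = T_i(f'). *)
Lemma taylorM nu f g t : smooth_on nu f -> smooth_on nu g -> U t ->
  taylor nu (fun t => f t * g t) t =
  \sum_(i < nu.+1) taylor i f t * taylor (nu - i) g t.
Proof.
elim: nu f g => [|nu IH] f g sf sg Ut.
  by rewrite big_ord1 /taylor !derivC0 fact0 !divr1.
have n0 : nu.+1%:R != 0 :> C by rewrite pnatr_eq0.
apply: (mulfI n0); rewrite -taylorS.
have [s1 s2] := (smooth_onW sf, smooth_onW sg).
have [s1' s2'] := (sf.2, sg.2).
have e1 : taylor nu (derivC 1 (fun t => f t * g t)) t =
   taylor nu (fun t => derivC 1 f t * g t) t + taylor nu (fun t => f t * derivC 1 g t) t.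
  rewrite /taylor -mulrDl -derivCD //; [|exact: smooth_onM|exact: smooth_onM].
  congr (_ / _); apply: derivC_eq_on; last by rewrite inE.
    move=> u /set_mem Uu.
    by rewrite (derivC1 (curve_deriveM (smooth_on_cderiv sf Uu) (smooth_on_cderiv sg Uu))).
  exact: (smooth_onM sf sg).2.
rewrite e1 !IH //.
(* Up to a boundary term of weight zero, the two sums run over the same products [F j] with weights
   j and nu + 1 - j, which add up to nu + 1. *)
pose F j := taylor j f t * taylor (nu.+1 - j) g t.
have -> : \sum_(i < nu.+1) taylor i (derivC 1 f) t * taylor (nu - i) g t =
   \sum_(j < nu.+2) j%:R * F j.
  rewrite [RHS]big_ord_recl mul0r add0r; apply: eq_bigr => i _.
  by rewrite taylorS /F lift0 subSS mulrA.
have -> : \sum_(i < nu.+1) taylor i f t * taylor (nu - i) (derivC 1 g) t =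
   \sum_(j < nu.+2) (nu.+1 - j)%:R * F j.
  rewrite [RHS]big_ord_recr /= subnn mul0r addr0; apply: eq_bigr => i _.
  have hi : (i <= nu)%N by rewrite -ltnS.
  by rewrite taylorS /F subSn // mulrCA.
rewrite -big_split /= mulr_sumr; apply: eq_bigr => i _.
by rewrite -mulrDl -natrD subnKC // -ltnS.
Qed.

End OnOpenSet.

Lemma smooth_onP (U : set R) f : (forall t, U t -> forall nu,
    derivable (derive1n nu (fun u => complex.Re (f u))) t 1 /\
    derivable (derive1n nu (fun u => complex.Im (f u))) t 1) ->
  forall k, smooth_on U k f.
Proof.
move=> h k; elim: k f h => [|k IH] f h.
  by split => // t Ut; apply/curve_deriveP; exact: (h t Ut 0%N).
split; first by move=> t Ut; apply/curve_deriveP; exact: (h t Ut 0%N).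
apply: IH => t Ut nu; have := h t Ut nu.+1.
by rewrite /derive1n !iterSr.
Qed.

Lemma taylor_inverse (U : set R) f g t : open U -> (forall k, smooth_on U k f) ->
  (forall u, U u -> f u != 0) -> (forall u, U u -> g u = (f u)^-1) -> U t ->
  forall nu, \sum_(i < nu.+1) taylor i f t * taylor (nu - i) g t = (nu == 0%N)%:R.
Proof.
move=> oU sf f0 gV Ut nu.
have sg k : smooth_on U k g.
  apply: (smooth_on_eq oU _ (smooth_onV oU f0 (sf k))) => u /set_mem Uu.
  by rewrite gV.
rewrite -(taylorM oU) //.
rewrite /taylor -(@derivC_eq_on U oU nu (fun=> 1)) ?inE //; last first.
- exact: smooth_on_cst.
- by move=> u /set_mem Uu; rewrite gV // mulfV // f0.
pose F k : R -> C := if k is 0 then fun=> 1 else fun=> 0.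
have dF k u : curve_derive (F k) u (F k.+1 u) by case: k => [|k]; exact: curve_derive_cst.
by rewrite [derivC _ _](derivC_all dF); case: (nu) => [|k]; rewrite ?fact0 ?divr1 ?mul0r.
Qed.

End CurveDerivatives.

(** * Jets of loops *)

Section Loops.
Context {R : realType}.
Local Notation C := R[i].
Implicit Types (t : R) (p : {poly C}).

(** The loop exp (2 pi i (t - t0)); [circ_freq] is 2 pi i. *)
Definition circ (t0 t : R) : C :=
  Complex (cos (pi *+ 2 * (t - t0))) (sin (pi *+ 2 * (t - t0))).

Definition circ_freq : C := Complex 0 (pi *+ 2).

Lemma circ_cderiv t0 t : curve_derive (circ t0) t (circ_freq * circ t0 t).
Proof.
have d : is_derive t (1 : R) (fun u => pi *+ 2 * (u - t0)) (pi *+ 2).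
  apply: is_derive_eq; rewrite oppr0 addr0 /GRing.scale /=.
  by rewrite mulr1.
split.
  apply: (is_derive_eq (is_derive1_comp (is_derive_cos _) d)).
  by rewrite /circ_freq /=; ring.
apply: (is_derive_eq (is_derive1_comp (is_derive_sin _) d)).
by rewrite /circ_freq /=; ring.
Qed.

Lemma circ_periodic t0 t : circ t0 (t + 1) = circ t0 t.
Proof.
rewrite /circ; have -> : pi *+ 2 * (t + 1 - t0) = pi *+ 2 * (t - t0) + pi *+ 2 by ring.
by rewrite (cosD (_ * _)) (sinD (_ * _)) cos2pi sin2pi !mulr1 !mulr0 subr0 addr0.
Qed.

Lemma circ_t0 t0 : circ t0 t0 = 1.
Proof. by rewrite /circ subrr mulr0 cos0 sin0. Qed.

(** d/dt acting on trigonometric polynomials p (circ t): it multiplies the coefficient of index k by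
    2 pi i k. *)
Definition circ_der p : {poly C} := circ_freq *: ('X * p^`()).

Lemma horner_circ_cderiv p t0 t :
  curve_derive (fun t => p.[circ t0 t]) t (circ_der p).[circ t0 t].
Proof.
have he := circ_cderiv t0 t; set e := circ t0 in he *.
have -> : (circ_der p).[e t] = p^`().[e t] * (circ_freq * e t).
  by rewrite /circ_der hornerZ hornerM hornerX; ring.
elim/poly_ind: p => [|p c IH].
  have -> : (fun t => (0 : {poly C}).[e t]) = fun=> 0.
    by apply/funext => u; rewrite horner0.
  by rewrite deriv0 horner0 mul0r; exact: curve_derive_cst.
have -> : (fun t => (p * 'X + c%:P).[e t]) = fun t => p.[e t] * e t + c.
  by apply/funext => u; rewrite hornerMXaddC.
have -> : (p * 'X + c%:P)^`().[e t] * (circ_freq * e t) =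
    p^`().[e t] * (circ_freq * e t) * e t + p.[e t] * (circ_freq * e t) + 0.
  by rewrite derivD poly.derivC addr0 derivM derivX mulr1 hornerD hornerMX; ring.
apply: curve_deriveD; last exact: curve_derive_cst.
exact: curve_deriveM.
Qed.

Lemma coef_circ_der nu p k :
  (iter nu circ_der p)`_k = (circ_freq * k%:R) ^+ nu * p`_k.
Proof.
elim: nu => [|nu IH]; first by rewrite mul1r.
rewrite iterS /circ_der coefZ coefXM exprS -mulrA -IH.
case: k {IH} => [|k] /=; first by rewrite mulr0 mul0r.
by rewrite coef_deriv -[in LHS]mulr_natl mulrA.
Qed.

Lemma circ_freq_neq0 : circ_freq != 0.
Proof. by rewrite eq_complex /= negb_and orbC gt_eqF // pmulrn_lgt0 // pi_gt0. Qed.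

(** A trigonometric polynomial with n frequencies: its derivatives at [t0] are the power sums of the
    nodes 2 pi i k weighted by its coefficients, so a Vandermonde system with distinct nodes has to
    be solved. *)
Lemma curve_with_jet (n : nat) (v : nat -> C) t0 :
  exists F : nat -> R -> C, [/\ forall nu t, curve_derive (F nu) t (F nu.+1 t),
    forall t, F 0%N (t + 1) = F 0%N t & forall nu, (nu < n)%N -> F nu t0 = v nu].
Proof.
case: n => [|n].
  by exists (fun _ _ => 0); split => // nu t; exact: curve_derive_cst.
pose x (k : nat) : C := circ_freq * k%:R.
have x_inj : injective x.
  by move=> i j /(mulfI circ_freq_neq0) /eqP; rewrite eqr_nat => /eqP.
pose l k : {poly C} := tnth (lagrange n.+1 x) k.
(* The coefficients of the Lagrange polynomials form the inverse Vandermonde matrix: interpolation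
   of X^nu at the nodes is X^nu itself. *)
pose p := \poly_(k < n.+1) (\sum_(m < n.+1) v m * (l (inord k))`_m).
exists (fun nu t => (iter nu circ_der p).[circ t0 t]); split.
- by move=> nu t; exact: horner_circ_cderiv.
- by move=> t; rewrite circ_periodic.
move=> nu hnu; rewrite circ_t0.
have sp : (size (iter nu circ_der p) <= n.+1)%N.
  apply/leq_sizeP => k hk; rewrite coef_circ_der nth_default ?mulr0 //.
  by apply: leq_trans hk; exact: size_poly.
rewrite (horner_coef_wide _ sp).
transitivity (\sum_(m < n.+1) v m * ('X^nu : {poly C})`_m); last first.
  rewrite (bigD1 (Ordinal hnu)) //= coefXn eqxx mulr1 big1 ?addr0 // => m.
  by rewrite -val_eqE /= coefXn => /negbTE ->; rewrite mulr0.
have sX : (size ('X^nu : {poly C}) <= n.+1)%N by rewrite size_polyXn.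
rewrite (lagrange_gen (isT : (0 < n.+1)%N) x_inj sX).
under [RHS]eq_bigr => m _ do rewrite coef_sum mulr_sumr.
rewrite exchange_big /=; apply: eq_bigr => k _.
rewrite expr1n mulr1 coef_circ_der /p coef_poly ltn_ord mulr_sumr.
apply: eq_bigr => m _.
by rewrite hornerXn coefCM inord_val /x; ring.
Qed.

Definition inf_loop_fun (f : R -> C) t : P1 R :=
  if f t == 0 then None else Some (f t)^-1.

Lemma inf_loop_dom f t : chart_dom Inf (inf_loop_fun f t).
Proof.
rewrite /inf_loop_fun /=; have [//|f0 [/eqP]] := eqVneq (f t) 0.
by rewrite invr_eq0 (negbTE f0).
Qed.

Lemma inf_loop_map f : chart_map Inf \o inf_loop_fun f = f.
Proof.
apply/funext => t; rewrite /inf_loop_fun /=.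
by have [->//|f0 /=] := eqVneq (f t) 0; rewrite invrK.
Qed.

Lemma loop_with_jet (n : nat) (v : nat -> C) t0 : exists x : loop R,
  [/\ chart_dom Inf (x t0), chart_map Inf (x t0) = derivC 0 (chart_map Inf \o x) t0 &
    forall nu, (nu < n)%N -> derivC nu (chart_map Inf \o x) t0 = v nu].
Proof.
have [F [dF perF F0]] := curve_with_jet n v t0.
have dn := derivC_all dF.
have sm : smooth (inf_loop_fun (F 0%N)).
  move=> s; exists Inf; near=> t; split; first exact: inf_loop_dom.
  move=> nu; have -> : (fun u => complex.Re (chart_map Inf (inf_loop_fun (F 0%N) u))) =
     fun u => complex.Re (F 0%N u).
    exact: (congr1 (fun h u => complex.Re (h u)) (inf_loop_map (F 0%N))).
  have -> : (fun u => complex.Im (chart_map Inf (inf_loop_fun (F 0%N) u))) =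
     fun u => complex.Im (F 0%N u).
    exact: (congr1 (fun h u => complex.Im (h u)) (inf_loop_map (F 0%N))).
  have [d1 d2] := dF nu t.
  have -> : derive1n nu (fun u => complex.Re (F 0%N u)) = fun u => complex.Re (F nu u).
    by apply/funext => u; have := congr1 (fun h => complex.Re (h u)) (dn nu).
  have -> : derive1n nu (fun u => complex.Im (F 0%N u)) = fun u => complex.Im (F nu u).
    by apply/funext => u; have := congr1 (fun h => complex.Im (h u)) (dn nu).
  by split; [case: d1 | case: d2].
have per t : inf_loop_fun (F 0%N) (t + 1) = inf_loop_fun (F 0%N) t.
  by rewrite /inf_loop_fun perF.
exists (Loop sm per); split => /=.
- exact: inf_loop_dom.
- by rewrite derivC0.
- by move=> nu hnu; rewrite inf_loop_map dn F0.
Unshelve. all: by end_near. Qed.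

Lemma near_neq0 (f : R -> C) t d : curve_derive f t d -> f t != 0 ->
  \forall u \near t, f u != 0.
Proof.
move=> [[d1 _] [d2 _]] ft0.
have c1 := (@differentiable_continuous _ _ _ _ _ ((derivable1_diffP _ _).1 d1)).
have c2 := (@differentiable_continuous _ _ _ _ _ ((derivable1_diffP _ _).1 d2)).
have [h|h] : complex.Re (f t) != 0 \/ complex.Im (f t) != 0.
  by move: ft0; rewrite eq_complex negb_and => /orP.
- apply: filterS (cvgr_neq0 _ c1 h) => u; apply: contraNneq => ->; by rewrite eqxx.
- apply: filterS (cvgr_neq0 _ c2 h) => u; apply: contraNneq => ->; by rewrite eqxx.
Qed.

(** Smoothness at [t0] is given in one chart only. Near [t0] the reading in that chart has no zero,
    and the reading in the other chart is its inverse, hence smooth too. *)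
Lemma loop_taylor_inverse (x : loop R) t0 : x t0 <> None -> x t0 <> Some 0 ->
  forall nu, \sum_(i < nu.+1) taylor i (chart_map Fin \o x) t0 *
    taylor (nu - i) (chart_map Inf \o x) t0 = (nu == 0%N)%:R.
Proof.
move=> xN x0 nu; have [i hi] := loop_smooth x t0.
have map0 : forall i, (chart_map i \o x) t0 != 0.
  case => /=; case: (x t0) xN x0 => // z _ z0; last rewrite invr_eq0;
    by apply/eqP => zE; apply: z0; rewrite zE.
pose P t := chart_dom i (x t) /\ (forall nu,
      derivable (derive1n nu (fun u => complex.Re (chart_map i (x u)))) t 1 /\
      derivable (derive1n nu (fun u => complex.Im (chart_map i (x u)))) t 1).
have [d hd] : exists d, curve_derive (chart_map i \o x) t0 d.
  by have [_ h] := nbhs_singleton hi; apply/curve_deriveP; exact: (h 0%N).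
have nz := near_neq0 hd (map0 i).
have hU : nbhs t0 [set t | P t /\ (chart_map i \o x) t != 0] by exact: filterI hi nz.
move: hU; rewrite nbhsE => hU; case: hU => U [oU Ut0] sU.
have sf k : smooth_on U k (chart_map i \o x).
  by apply: smooth_onP => t Ut; have [[_ h] _] := sU t Ut; exact: h.
have f0 u : U u -> (chart_map i \o x) u != 0 by move=> Uu; have [_] := sU u Uu.
have dom u : U u -> chart_dom i (x u) by move=> Uu; have [[]] := sU u Uu.
case: i sf f0 dom {hi map0 P d hd nz sU} => sf f0 dom.
  apply: (taylor_inverse oU sf f0 _ Ut0) => u Uu /=.
  by have := dom u Uu; have := f0 u Uu; rewrite /=; case: (x u).
(* In the chart [Inf] the two factors change roles, so the sum is reversed. *)
rewrite -(taylor_inverse oU sf f0 (g := chart_map Fin \o x) _ Ut0); last first.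
  move=> u Uu /=; have := f0 u Uu; rewrite /=; case: (x u) => [z|] /=; last by rewrite eqxx.
  by rewrite invrK.
rewrite (reindex_inj rev_ord_inj) /=; apply: eq_bigr => i _.
by rewrite mulrC subSS subKn // -ltnS.
Qed.

Section JetCoordinates.
Variables (k : nat) (t0 : R).

Lemma jet_of_loop (x : loop R) :
  jet_target (\pi_(jet k t0) x) = x t0 /\
  forall i, chart_dom i (x t0) -> forall nu, (nu <= k)%N ->
    derivC nu (chart_map i \o (repr (\pi_(jet k t0) x) : loop R)) t0 =
    derivC nu (chart_map i \o x) t0.
Proof.
have : same_jet k t0 (repr (\pi_(jet k t0) x)) x.
  by apply/eqmodP; rewrite reprK.
by move=> /asboolP[e h]; split => // i di nu hnu; apply: h => //; rewrite e.
Qed.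

End JetCoordinates.

End Loops.

(** * Holomorphic functions of several variables *)

Section HolomorphicFunctions.
Context {R : realType}.
Local Notation C := R[i].
Variable m : nat.
Implicit Types (h : 'rV[C]_m -> C) (v : 'rV[C]_m).

Lemma holomorphic_cst (c : C) : holomorphic (fun _ : 'rV[C]_m => c).
Proof. by move=> v; exact: differentiable_cst. Qed.

Lemma holomorphicD h1 h2 : holomorphic h1 -> holomorphic h2 ->
  holomorphic (fun v => h1 v + h2 v).
Proof. by move=> H1 H2 v; exact: (differentiableD (H1 v) (H2 v)). Qed.

Lemma holomorphicM h1 h2 : holomorphic h1 -> holomorphic h2 ->
  holomorphic (fun v => h1 v * h2 v).
Proof. by move=> H1 H2 v; exact: (differentiableM (H1 v) (H2 v)). Qed.

Lemma holomorphicX h k : holomorphic h -> holomorphic (fun v => h v ^+ k).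
Proof.
move=> H; elim: k => [|k IH]; first exact: holomorphic_cst.
have -> : (fun v => h v ^+ k.+1) = fun v => h v * h v ^+ k.
  by apply/funext => v; rewrite exprS.
exact: holomorphicM.
Qed.

Lemma holomorphic_sum (I : Type) (r : seq I) (P : pred I) (F : I -> 'rV[C]_m -> C) :
  (forall i, holomorphic (F i)) -> holomorphic (fun v => \sum_(i <- r | P i) F i v).
Proof.
move=> H; elim: r => [|i r IH].
  have -> : (fun v => \sum_(i <- [::] | P i) F i v) = fun=> 0.
    by apply/funext => v; rewrite big_nil.
  exact: holomorphic_cst.
case Pi : (P i).
  have -> : (fun v => \sum_(i <- i :: r | P i) F i v) =
      fun v => F i v + \sum_(i <- r | P i) F i v.
    by apply/funext => v; rewrite big_cons Pi.
  exact: holomorphicD.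
have -> : (fun v => \sum_(i <- i :: r | P i) F i v) =
    fun v => \sum_(i <- r | P i) F i v.
  by apply/funext => v; rewrite big_cons Pi.
exact: IH.
Qed.

Lemma holomorphic_prod (I : Type) (r : seq I) (F : I -> 'rV[C]_m -> C) :
  (forall i, holomorphic (F i)) -> holomorphic (fun v => \prod_(i <- r) F i v).
Proof.
move=> H; elim: r => [|i r IH].
  have -> : (fun v => \prod_(i <- [::]) F i v) = fun=> 1.
    by apply/funext => v; rewrite big_nil.
  exact: holomorphic_cst.
have -> : (fun v => \prod_(i <- i :: r) F i v) = fun v => F i v * \prod_(i <- r) F i v.
  by apply/funext => v; rewrite big_cons.
exact: holomorphicM.
Qed.

(** Needed for the sections over P1, where m = 1, and for the line of jets of w = z + t. *)
Lemma holomorphic_line h (a b : 'rV[C]_m) : holomorphic h ->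
  entire (fun z => h (z *: a + b)).
Proof.
move=> H z; pose f (y : C) := h (y *: a + (z *: a + b)).
have df : derivable (f : C^o -> C^o) (0 : C^o) (1 : C^o).
  have /(@diff_derivable _ _ _ _ _ a)/derivable1P := H (z *: a + b).
  by [].
have /derivable1_diffP/cder_differentiable[d hd] := df.
exists d => e e0; have [r r0 hr] := hd e e0.
exists r => // c cr; have := hr c cr; rewrite /f add0r scale0r add0r.
by have -> : c *: a + (z *: a + b) = (z + c) *: a + b by rewrite scalerDl addrCA addrA.
Qed.

(* 0 when k >= m *)
Definition ent v (k : nat) : C := oapp (fun i : 'I_m => v 0 i) 0 (insub k).

Lemma ent_ord v (i : 'I_m) : ent v i = v 0 i.
Proof. by rewrite /ent valK. Qed.

Lemma holomorphic_ent k : holomorphic (fun v => ent v k).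
Proof.
rewrite /ent; case: insubP => [i _ _|_] /=; last exact: holomorphic_cst.
by move=> v; exact: differentiable_coord.
Qed.

Lemma entire_horner (p : {poly C}) : entire (fun z => p.[z]).
Proof. by move=> z; exists p^`().[z]; exact: cder_horner. Qed.

(** q is bounded by K near 0, hence |c| <= x (1 + K) for every small real x > 0. *)
Lemma entire_div_cst0 (q : C -> C) c : entire q -> (forall z, z != 0 -> c = z * q z) -> c = 0.
Proof.
move=> Q hc; apply/Normc.eq0_normc/eqP; rewrite eq_le normc_ge0 andbT.
have [d hd] := Q 0; have [r r0 hr] := hd 1 ltr01.
pose K := Normc.normc (q 0) + (1 + Normc.normc d) * r.
have K1 : 0 < 1 + K.
  by rewrite ltr_pwDl // addr_ge0 ?normc_ge0 // mulr_ge0 ?addr_ge0 ?normc_ge0 // ltW.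
apply/ler_addgt0Pr => e e0; rewrite add0r.
pose x := Num.min r (e / (1 + K)).
have x0 : 0 < x by rewrite /x lt_min r0 divr_gt0.
have xr : x <= r by rewrite /x ge_min lexx.
have xe : x * (1 + K) <= e by rewrite -ler_pdivlMr // /x ge_min lexx orbT.
have xC : x%:C%C != 0 by rewrite eq_complex /= eqxx andbT gt_eqF.
rewrite (hc _ xC) Normc.normcM normc_real gtr0_norm //.
apply: le_trans xe; rewrite ler_pM2l //.
have nx : Normc.normc x%:C%C = x by rewrite normc_real gtr0_norm.
have := hr x%:C%C; rewrite nx => /(_ xr); rewrite add0r mul1r => h1.
have -> : q x%:C%C = (q x%:C%C - q 0 - d * x%:C%C) + d * x%:C%C + q 0 by ring.
apply: le_trans (normc_triangle _ _) _.
have : Normc.normc (q x%:C%C - q 0 - d * x%:C%C + d * x%:C%C) <= (1 + Normc.normc d) * r.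
  apply: le_trans (normc_triangle _ _) _; rewrite Normc.normcM nx mulrDl mul1r.
  by apply: lerD; [exact: le_trans xr | rewrite ler_wpM2l ?normc_ge0].
rewrite /K; lra.
Qed.

Lemma poly_low_coef0 (k : nat) (p : {poly C}) (g : C -> C) : entire g ->
  (forall z, z != 0 -> p.[z] = z ^+ k * g z) -> forall i, (i < k)%N -> p`_i = 0.
Proof.
move=> G; elim: k p => [//|k IH] p.
elim/poly_ind: p => [|p c _] hp i; first by rewrite coef0.
have c0 : c = 0.
  (* From p(z) z + c = z^(k+1) g(z), the constant c is z times this entire function. *)
  apply: (@entire_div_cst0 (fun z => z ^+ k * g z + - p.[z])).
    apply: entireD; last first.
      apply: (entire_comp (h1 := -%R)); last exact: entire_horner.
      by move=> z; exists (- 1); apply: cderN; exact: cder_id.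
    apply: entireM => //.
    have -> : (fun z : C => z ^+ k) = fun z => ('X^k).[z] by apply/funext => z; rewrite hornerXn.
    exact: entire_horner.
  move=> z z0; have := hp z z0; rewrite hornerMXaddC exprS => h1.
  by rewrite mulrDr mulrA -h1; ring.
case: i => [|i] hi; first by rewrite coefD coefMX c0 coefC add0r.
rewrite coefD coefMX coefC /= addr0; apply: IH => // z z0.
have := hp z z0; rewrite hornerMXaddC c0 addr0 exprS => h1.
by apply: (mulIf z0); rewrite h1; ring.
Qed.

End HolomorphicFunctions.

(** * Polynomials of small pole order *)

Section RegularPolynomials.
Context {R : realType}.
Local Notation C := R[i].
Variable n : nat.
Hypothesis n_gt0 : (0 < n)%N.
Implicit Types (u v : 'rV[C]_n) (p q : jpoly R n) (k l a b i : nat).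

Definition tcoef v k : C := ent v k / k`!%:R.

Lemma holomorphic_tcoef k : holomorphic (fun v : 'rV[C]_n => tcoef v k).
Proof. by apply: holomorphicM; [exact: holomorphic_ent | exact: holomorphic_cst]. Qed.

Lemma tcoef0 v : tcoef v 0 = ent v 0.
Proof. by rewrite /tcoef fact0 divr1. Qed.

(* The jets with coordinates u and v, up to order n - 1, have product 1. *)
Definition inverse_jets v u := forall nu, (nu < n)%N ->
  \sum_(i < nu.+1) tcoef u i * tcoef v (nu - i) = (nu == 0%N)%:R.

(** No [u] is inverse to a [v] with [ent v 0 = 0]; the condition is that [G] stays holomorphic
    across that hyperplane. *)
Definition regular p := exists2 G : 'rV[C]_n -> C, holomorphic G &
  forall v u, inverse_jets v u -> ent v 0 ^+ n * jpoly_fun p u = G v.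

Lemma inverse_jets0 v u : inverse_jets v u -> tcoef u 0 * ent v 0 = 1.
Proof. by move=> /(_ 0%N n_gt0); rewrite big_ord1 subnn tcoef0. Qed.

Lemma inverse_jetsS v u a : (0 < a < n)%N -> inverse_jets v u ->
  ent v 0 * tcoef u a = - \sum_(i < a) tcoef u i * tcoef v (a - i).
Proof.
move=> /andP[a0 an] /(_ a an); rewrite big_ord_recr /= subnn tcoef0.
by rewrite gtn_eqF // => /eqP; rewrite addrC addr_eq0 mulrC => /eqP.
Qed.

(** The recurrence [inverse_jetsS] expresses [ent v 0] times a coefficient through the earlier ones,
    so each index adds at most one to the pole order. *)
Lemma pole_tcoef a : (a < n)%N -> exists2 G : 'rV[C]_n -> C, holomorphic G &
  forall v u, inverse_jets v u -> ent v 0 ^+ a.+1 * tcoef u a = G v.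
Proof.
elim/ltn_ind: a => -[|a] IH an.
  exists (fun=> 1); first exact: holomorphic_cst.
  by move=> v u /inverse_jets0; rewrite expr1 mulrC.
have /choice[G hG] : forall i : 'I_a.+1, exists G : 'rV[C]_n -> C, holomorphic G /\
    forall v u, inverse_jets v u -> ent v 0 ^+ i.+1 * tcoef u i = G v.
  by move=> i; have [|G ? ?] := IH i (ltn_ord i); [exact: ltn_trans an | exists G].
exists (fun v => \sum_(i < a.+1) - (ent v 0 ^+ (a - i) * tcoef v (a.+1 - i) * G i v)).
  apply: holomorphic_sum => i.
  have -> : (fun v => - (ent v 0 ^+ (a - i) * tcoef v (a.+1 - i) * G i v)) =
     fun v => -1 * (ent v 0 ^+ (a - i) * tcoef v (a.+1 - i) * G i v).
    by apply/funext => v; rewrite mulN1r.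
  apply: holomorphicM; first exact: holomorphic_cst.
  apply: holomorphicM; last by have [] := hG i.
  by apply: holomorphicM; [apply: holomorphicX; exact: holomorphic_ent | exact: holomorphic_tcoef].
move=> v u vu; rewrite exprSr -mulrA inverse_jetsS //.
rewrite mulrN mulr_sumr sumrN; congr (- _); apply: eq_bigr => i _.
have [_ hGi] := hG i; rewrite -(hGi v u vu).
have hi : (i <= a)%N by rewrite -ltnS.
have -> : ent v 0 ^+ a.+1 = ent v 0 ^+ (a - i) * ent v 0 ^+ i.+1.
  by rewrite -exprD addnS subnK.
by ring.
Qed.

(** The Taylor coefficients of t times the curve with jet [u]. *)
Definition tcoef_shift u k : C := if k is k'.+1 then tcoef u k' else 0.

(** Rows a and b of the two-column matrix with columns u and t u, that is y_a y_(b-1) - y_(a-1) y_b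
    with y_(-1) = 0. *)
Definition minor u a b : C :=
  tcoef u a * tcoef_shift u b - tcoef_shift u a * tcoef u b.

Lemma minorC u a b : minor u a b = - minor u b a.
Proof. by rewrite /minor; ring. Qed.

(* The pole has order a + 1 instead of a + b + 1 because the minors obey the same
   recurrence as the coefficients of u. *)
Lemma pole_minor a b : (b < a < n)%N -> exists2 G : 'rV[C]_n -> C, holomorphic G &
  forall v u, inverse_jets v u -> ent v 0 ^+ a.+1 * minor u a b = G v.
Proof.
elim/ltn_ind: a b => -[|[|a]] IH b; first by rewrite ltn0.
  (* Index 1 is treated apart: the product of t u and v is t, so the homogeneous recurrence for the
     shifted column starts only at index 2. *)
  rewrite ltnS leqn0 => /andP[/eqP-> _].
  exists (fun=> -1); first exact: holomorphic_cst.
  move=> v u /inverse_jets0 h.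
  have -> : ent v 0 ^+ 2 * minor u 1 0 = - (tcoef u 0 * ent v 0) ^+ 2.
    by rewrite /minor /=; ring.
  by rewrite h expr1n.
move=> /andP[ba an].
have /choice[G hG] : forall i : 'I_a.+2, exists G : 'rV[C]_n -> C, holomorphic G /\
    forall v u, inverse_jets v u -> ent v 0 ^+ a.+2 * minor u i b = G v.
  move=> i; have [ib|bi|->] := ltngtP i b.
  - have [|G hG G1] := IH b ba i; first by rewrite ib (ltn_trans ba).
    exists (fun v => ent v 0 ^+ (a.+1 - b) * (-1 * G v)); split.
      apply: holomorphicM; first by apply: holomorphicX; exact: holomorphic_ent.
      by apply: holomorphicM => //; exact: holomorphic_cst.
    move=> v u vu; rewrite -(G1 v u vu) minorC.
    have -> : ent v 0 ^+ a.+2 = ent v 0 ^+ (a.+1 - b) * ent v 0 ^+ b.+1.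
      by rewrite -exprD addnS subnK.
    by ring.
  - have [|G hG G1] := IH i (ltn_ord i) b; first by rewrite bi (ltn_trans _ an).
    exists (fun v => ent v 0 ^+ (a.+1 - i) * G v); split.
      by apply: holomorphicM => //; apply: holomorphicX; exact: holomorphic_ent.
    move=> v u vu; rewrite -(G1 v u vu).
    have hi : (i <= a.+1)%N by rewrite -ltnS.
    have -> : ent v 0 ^+ a.+2 = ent v 0 ^+ (a.+1 - i) * ent v 0 ^+ i.+1.
      by rewrite -exprD addnS subnK.
    by ring.
  - exists (fun=> 0); split; first exact: holomorphic_cst.
    by move=> v u _; rewrite /minor; ring.
exists (fun v => \sum_(i < a.+2) -1 * (tcoef v (a.+2 - i) * G i v)).
  apply: holomorphic_sum => i; apply: holomorphicM; first exact: holomorphic_cst.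
  by apply: holomorphicM; [exact: holomorphic_tcoef | have [] := hG i].
move=> v u vu.
(* The minor is linear in its first row, and both columns satisfy the recurrence: u at index a + 2,
   and t u by the relation for u at index a + 1. *)
have E : ent v 0 * minor u a.+2 b = - \sum_(i < a.+2) minor u i b * tcoef v (a.+2 - i).
  have e1 := inverse_jetsS (a := a.+2) an vu.
  have e2 := inverse_jetsS (a := a.+1) (ltnW an) vu.
  have -> : ent v 0 * minor u a.+2 b =
      (ent v 0 * tcoef u a.+2) * tcoef_shift u b - (ent v 0 * tcoef u a.+1) * tcoef u b.
    by rewrite /minor /=; ring.
  rewrite e1 e2.
  have -> : \sum_(i < a.+1) tcoef u i * tcoef v (a.+1 - i) =
      \sum_(i < a.+2) tcoef_shift u i * tcoef v (a.+2 - i).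
    by rewrite [RHS]big_ord_recl mul0r add0r; apply: eq_bigr => i _.
  rewrite !mulNr !mulr_suml -opprD; congr (- _); rewrite -sumrB.
  by apply: eq_bigr => i _; rewrite /minor; ring.
rewrite exprSr -mulrA E mulrN mulr_sumr -sumrN; apply: eq_bigr => i _.
by rewrite -((hG i).2 v u vu); ring.
Qed.

Lemma jpoly_fun_xder k u : jpoly_fun (xder R n k) u = ent u k.
Proof.
rewrite /xder /ent /jpoly_fun; case: insubP => [i _ _|_] /=.
  by rewrite mpoly.mevalXU.
by rewrite mpoly.meval0.
Qed.

Lemma jpoly_funD p q u : jpoly_fun (p + q) u = jpoly_fun p u + jpoly_fun q u.
Proof. exact: mpoly.mevalD. Qed.

Lemma jpoly_funB p q u : jpoly_fun (p - q) u = jpoly_fun p u - jpoly_fun q u.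
Proof. exact: mpoly.mevalB. Qed.

Lemma jpoly_funM p q u : jpoly_fun (p * q) u = jpoly_fun p u * jpoly_fun q u.
Proof. exact: mpoly.mevalM. Qed.

Lemma jpoly_funZ (c : C) p u : jpoly_fun (c *: p) u = c * jpoly_fun p u.
Proof. exact: mpoly.mevalZ. Qed.

Lemma holomorphic_jpoly_fun p : holomorphic (jpoly_fun p).
Proof.
have -> : jpoly_fun p = fun v => \sum_(m <- mpoly.msupp p)
    mpoly.mcoeff m p * \prod_i v 0 i ^+ m i.
  by apply/funext => v; rewrite /jpoly_fun mpoly.mevalE.
apply: holomorphic_sum => m; apply: holomorphicM; first exact: holomorphic_cst.
apply: holomorphic_prod => i; apply: holomorphicX => v; exact: differentiable_coord.
Qed.

Lemma regular0 : regular 0.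
Proof.
exists (fun=> 0); first exact: holomorphic_cst.
by move=> v u _; rewrite /jpoly_fun mpoly.meval0 mulr0.
Qed.

Lemma regularD p q : regular p -> regular q -> regular (p + q).
Proof.
move=> [G hG G1] [H hH H1]; exists (fun v => G v + H v); first exact: holomorphicD.
by move=> v u vu; rewrite -(G1 v u vu) -(H1 v u vu) jpoly_funD mulrDr.
Qed.

Lemma regularZ (c : C) p : regular p -> regular (c *: p).
Proof.
move=> [G hG G1]; exists (fun v => c * G v).
  by apply: holomorphicM => //; exact: holomorphic_cst.
by move=> v u vu; rewrite -(G1 v u vu) jpoly_funZ mulrCA.
Qed.

Lemma regular_low a b : (a + b + 2 <= n)%N -> regular (xder R n a * xder R n b).
Proof.
move=> abn.
have [|G hG G1] := @pole_tcoef a; first by lia.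
have [|H hH H1] := @pole_tcoef b; first by lia.
exists (fun v => (a`!%:R * b`!%:R) * (ent v 0 ^+ (n - (a.+1 + b.+1)) * (G v * H v))).
  apply: holomorphicM; first exact: holomorphic_cst.
  apply: holomorphicM; last exact: holomorphicM.
  by apply: holomorphicX; exact: holomorphic_ent.
move=> v u vu; rewrite -(G1 v u vu) -(H1 v u vu) jpoly_funM !jpoly_fun_xder.
have fE k : ent u k = k`!%:R * tcoef u k.
  by rewrite /tcoef mulrCA mulfV ?mulr1 // pnatr_eq0 -lt0n fact_gt0.
have -> : ent v 0 ^+ n = ent v 0 ^+ (n - (a.+1 + b.+1)) * ent v 0 ^+ a.+1 * ent v 0 ^+ b.+1.
  by rewrite -!exprD; congr (_ ^+ _); lia.
by rewrite !fE; ring.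
Qed.

(** With x^(k) = k! y_k, the factor k1 / (k2 + 1) turns (k1 - 1)! (k2 + 1)! into k1! k2!, so the
    polynomial is k1! k2! times the minor of rows k1 and k2 + 1. *)
Lemma regular_high k1 k2 : (k1 < n)%N -> (k2 + 2 <= k1)%N ->
  regular (xder R n k1 * xder R n k2 -
    (k1%:R / (k2 + 1)%:R) *: (xder R n (k1 - 1) * xder R n (k2 + 1))).
Proof.
move=> k1n k21.
have [|G hG G1] := @pole_minor k1 k2.+1; first by lia.
exists (fun v => (k1`!%:R * k2`!%:R) * (ent v 0 ^+ (n - k1.+1) * G v)).
  apply: holomorphicM; first exact: holomorphic_cst.
  by apply: holomorphicM => //; apply: holomorphicX; exact: holomorphic_ent.
move=> v u vu; rewrite -(G1 v u vu) jpoly_funB jpoly_funZ !jpoly_funM !jpoly_fun_xder.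
have fE k : ent u k = k`!%:R * tcoef u k.
  by rewrite /tcoef mulrCA mulfV ?mulr1 // pnatr_eq0 -lt0n fact_gt0.
have -> : ent v 0 ^+ n = ent v 0 ^+ (n - k1.+1) * ent v 0 ^+ k1.+1.
  by rewrite -exprD; congr (_ ^+ _); lia.
rewrite !fE.
case: k1 k1n k21 {G1} => [|k1] k1n k21; first by lia.
rewrite /minor /= !addn1 subn1 /= !factS !natrM.
have kn : (k2.+1%:R != 0 :> C) by rewrite pnatr_eq0.
by field; rewrite addrC -natr1 in kn *.
Qed.

End RegularPolynomials.

(** * Holomorphic sections over P1 and over the jet space *)

Section SectionsOverJets.
Context {R : realType}.
Local Notation C := R[i].

Lemma section_constant (n : nat) (S : chart -> P1 R -> C) :
  hol_section_P1 n S -> (forall p, section_zero S p <-> p = None) ->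
  exists2 c, c != 0 & forall z, S Fin (Some z) = c.
Proof.
move=> [hS glue] zS.
have [h hh hF] := hS Fin; have [g hg hI] := hS Inf.
pose e : 'rV[C]_1 := const_mx 1.
have row_e z : \row_(_ < 1) z = z *: e + 0.
  by apply/rowP => i; rewrite !mxE mulr1 addr0.
have SF z : S Fin (Some z) = h (z *: e + 0) by rewrite hF //= row_e.
have SI z : z != 0 -> S Inf (Some z) = g (z^-1 *: e + 0).
  by move=> z0; rewrite hI //= ?row_e // => -[/eqP]; rewrite (negbTE z0).
have [||z z0|z|c c0 hc] := @nonvanishing_section_constant R n
    (fun z => h (z *: e + 0)) (fun z => g (z *: e + 0)).
- exact: holomorphic_line.
- exact: holomorphic_line.
- rewrite -SF -SI // glue //=.
  by move=> [/eqP]; rewrite (negbTE z0).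
- apply/eqP => hz; have [] : False.
  suff : section_zero S (Some z) by move=> /zS.
  case=> [_|z0]; first by rewrite SF.
  have /eqP zn0 : z <> 0 by move=> zE; apply: z0; rewrite zE.
  have zN : Some z <> None by [].
  have := glue (Some z) zN z0; rewrite SF hz /= => /esym/eqP.
  by rewrite mulf_eq0 expf_eq0 (negbTE zn0) andbF => /eqP.
- by exists c => // z; rewrite SF.
Qed.

Section JetsOfOrder.
Variables (n : nat) (t0 : R).
Hypothesis n_gt0 : (0 < n)%N.
Implicit Types (j : jet n.-1 t0).

Lemma ent_jet_coord i j nu : (nu < n)%N ->
  ent (jet_coord i j) nu = derivC nu (chart_map i \o (repr j : loop R)) t0.
Proof. by move=> hnu; rewrite (ent_ord _ (Ordinal hnu)) mxE. Qed.

Lemma ent0_jet_coord i j : ent (jet_coord i j) 0 = chart_map i (jet_target j).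
Proof. by rewrite ent_jet_coord // derivC0. Qed.

Lemma jet_coord_inverse j : jet_target j <> None -> jet_target j <> Some 0 ->
  inverse_jets (jet_coord Inf j) (jet_coord Fin j).
Proof.
move=> jN j0 nu hnu; rewrite -(loop_taylor_inverse jN j0 nu).
apply: eq_bigr => i _; have hi : (i < nu.+1)%N by [].
by rewrite /tcoef !ent_jet_coord //; lia.
Qed.

Lemma jet_with_inf_coord (v : 'rV[C]_n) : ent v 0 != 0 ->
  exists j, [/\ jet_target j <> None, jet_target j <> Some 0 & jet_coord Inf j = v].
Proof.
move=> v0; have [x [dx x0 hx]] := loop_with_jet n (ent v) t0.
have [tx cx] := jet_of_loop n.-1 t0 x.
set j := \pi_(jet n.-1 t0) x in tx cx.
exists j; rewrite tx; split.
- by move=> xN; move: x0; rewrite hx // xN /= => /eqP; rewrite eq_sym (negbTE v0).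
- exact: dx.
apply/rowP => k; rewrite mxE cx //; last by have := ltn_ord k; lia.
by rewrite hx // ent_ord.
Qed.

Variable (S : chart -> P1 R -> C) (c : C).
Hypotheses (c_neq0 : c != 0) (Sc : forall z, S Fin (Some z) = c).

Lemma regular_Pn p : regular p -> Pn n t0 S (jpoly_fun p).
Proof.
move=> [G hG G1].
(* The factor c compensates the division by [Sinf]. Over infinity the component is the extension
   [G], and the identity in [regular] is the gluing condition. *)
exists (fun i j => c * (if i is Fin then jpoly_fun p (jet_coord Fin j) else G (jet_coord Inf j))).
  split.
    case.
      exists (fun v => c * jpoly_fun p v) => //.
      by apply: holomorphicM; [exact: holomorphic_cst | exact: holomorphic_jpoly_fun].
    exists (fun v => c * G v) => //.
    by apply: holomorphicM; first exact: holomorphic_cst.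
  move=> j jN j0; have vu := jet_coord_inverse jN j0.
  rewrite -(G1 _ _ vu) ent0_jet_coord /=.
  move: jN j0; case: (jet_target j) => [z|//] /= _ z0.
  have /eqP zn0 : z <> 0 by move=> zE; apply: z0; rewrite zE.
  by rewrite mulrCA; congr (_ * _); rewrite mulrA -exprMn mulfV // expr1n mul1r.
move=> j; case: (jet_target j) => [z _|//].
by rewrite Sc mulrC mulKf.
Qed.

(** The factor between the monomial [m] in the derivatives x^(r) = r! y_r and the same monomial in
    the y_r. *)
Definition fact_mon (m : mpoly.multinom n) : nat := (\prod_(r < n) (r`! ^ m r))%N.

(* u is the jet of 1/(z + t). *)
Lemma mon_at_line (u : 'rV[C]_n) (z : C) (m : mpoly.multinom n) : z != 0 ->
  (forall r, (r < n)%N -> tcoef u r = (-1) ^+ r * z ^- r.+1) ->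
  \prod_(i < n) u 0 i ^+ m i =
  (fact_mon m)%:R * (-1) ^+ deriv_order m * z ^- (deriv_order m + mpoly.mdeg m).
Proof.
move=> z0 hu; rewrite mpoly.mdegE /deriv_order /fact_mon -big_split /= natr_prod.
rewrite !expr_sum -prodfV -!big_split /=; apply: eq_bigr => r _.
have -> : u 0 r = r`!%:R * ((-1) ^+ r * z ^- r.+1).
  by rewrite -hu // /tcoef ent_ord mulrCA mulfV ?mulr1 // pnatr_eq0 -lt0n fact_gt0.
rewrite !exprMn natrX mulrA -exprM exprVn -exprM.
by congr (_ * _ * _^-1); congr (_ ^+ _); lia.
Qed.

Lemma Pn_weight_sums p : Pn n t0 S (jpoly_fun p) ->
  (forall m, m \in mpoly.msupp p -> mpoly.mdeg m = 2%N) ->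
  forall l, (n <= l.+1)%N ->
  \sum_(m <- mpoly.msupp p | deriv_order m == l)
    mpoly.mcoeff m p * (fact_mon m)%:R = 0.
Proof.
move=> [s [hs glue] hp] hdeg l hl.
have [h hh hF] := hs Fin; have [G hG hI] := hs Inf.
(* z *: e0 + e1 is the jet of z + t. *)
pose e0 : 'rV[C]_n := \row_i ((i : nat) == 0%N)%:R.
pose e1 : 'rV[C]_n := \row_i ((i : nat) == 1%N)%:R.
have entv z k : (k < n)%N -> ent (z *: e0 + e1) k = z * (k == 0%N)%:R + (k == 1%N)%:R.
  by move=> kn; rewrite (ent_ord _ (Ordinal kn)) !mxE.
have ord_le m : m \in mpoly.msupp p -> (deriv_order m <= 2 * n.-1)%N.
  move=> /hdeg; rewrite mpoly.mdegE => <-; rewrite /deriv_order big_distrl /=.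
  by apply: leq_sum => i _; rewrite leq_mul2l -ltnS prednK // ltn_ord orbT.
(* This is z^(2 n) p(u) at the jet u of 1/(z + t): a monomial of degree 2 and weight l contributes
   z^(2 n - l - 2), and l <= 2 (n - 1). *)
pose P : {poly C} := \sum_(m <- mpoly.msupp p)
   (mpoly.mcoeff m p * (fact_mon m)%:R * (-1) ^+ deriv_order m) *:
     'X^(2 * n.-1 - deriv_order m).
have PG z : z != 0 -> P.[z] = z ^+ n * (c^-1 * G (z *: e0 + e1)).
  move=> z0; set v := z *: e0 + e1.
  have v0 : ent v 0 = z by rewrite entv // mulr1 addr0.
  have [|j [jN j0 jv]] := @jet_with_inf_coord v; first by rewrite v0.
  have vu := jet_coord_inverse jN j0; rewrite jv in vu.
  have tz : jet_target j = Some z^-1.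
    have := ent0_jet_coord Inf j; rewrite jv v0.
    by case: (jet_target j) jN => [w _ /= ->|//]; rewrite invrK.
  have := hp j jN; rewrite tz Sc (glue j jN j0) (hI j j0) jv tz /= => hpj.
  set u := jet_coord Fin j in vu hpj.
  (* Only the coefficients z and 1 of v are nonzero, so the recurrence reduces to z u_(r+1) = -
     u_r. *)
  have tu : forall r, (r < n)%N -> tcoef u r = (-1) ^+ r * z ^- r.+1.
    elim=> [|r IH] rn.
      have := inverse_jets0 n_gt0 vu; rewrite v0 => h1.
      by apply: (mulIf z0); rewrite h1 mul1r expr1 mulVf.
    have := inverse_jetsS (a := r.+1) rn vu; rewrite v0 big_ord_recr /= subSnn.
    have -> : tcoef v 1 = 1.
      by rewrite /tcoef entv ?(leq_trans _ rn) //= mulr0 add0r divr1.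
    rewrite big1 ?add0r; last first.
      move=> i _; have hi := ltn_ord i.
      rewrite /tcoef entv; last by lia.
      rewrite (_ : (r.+1 - i == 0)%N = false); last by lia.
      rewrite (_ : (r.+1 - i == 1)%N = false); last by lia.
      by rewrite mulr0 addr0 mul0r mulr0.
    rewrite mulr1 IH; last exact: ltnW.
    move=> h1; apply: (mulfI z0); rewrite h1 [(-1) ^+ r.+1]exprS mulN1r [z ^+ r.+2]exprS invfM.
    by rewrite mulrCA mulVKf // mulNr.
  have z2 : z ^+ (2 * n) != 0 by rewrite expf_eq0 (negbTE z0) andbF.
  have {}hpj : jpoly_fun p u = z ^- n * (c^-1 * G v).
    by rewrite hpj exprVn -mulrA; congr (_ * _); rewrite mulrC.
  rewrite (_ : c^-1 * G v = z ^+ n * jpoly_fun p u); last first.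
    by rewrite hpj mulVKf // expf_eq0 (negbTE z0) andbF.
  rewrite mulrA -exprD /P horner_sum /jpoly_fun mpoly.mevalE mulr_sumr.
  rewrite big_seq [RHS]big_seq; apply: eq_bigr => m mp.
  rewrite hornerZ hornerXn (mon_at_line m z0 tu) (hdeg m mp).
  have := ord_le m mp => om.
  have -> : z ^+ (n + n) = z ^+ (2 * n.-1 - deriv_order m) * z ^+ (deriv_order m + 2).
    by rewrite -exprD; congr (_ ^+ _); lia.
  have z3 : z ^+ (deriv_order m + 2) != 0 by rewrite expf_eq0 (negbTE z0) andbF.
  by field.
have gE : entire (fun z => c^-1 * G (z *: e0 + e1)).
  by apply: entireM; [exact: entire_cst | exact: holomorphic_line].
have [l2|l2] := leqP l (2 * n.-1); last first.
  rewrite big_seq_cond big1 // => m /andP[/ord_le ml /eqP mE].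
  by move: l2; rewrite -mE ltnNge ml.
(* The exponent 2 (n - 1) - l is below n exactly because l >= n - 1. The sign (-1)^l is common to
   the whole weight and is divided out. *)
have := poly_low_coef0 gE PG (i := 2 * n.-1 - l).
rewrite (_ : (2 * n.-1 - l < n)%N); last by lia.
move=> /(_ isT); rewrite /P coef_sum => PE.
apply: (mulIf (x := (-1) ^+ l)); first by rewrite signr_eq0.
rewrite mul0r -[RHS]PE mulr_suml big_mkcond /= big_seq [RHS]big_seq.
apply: eq_bigr => m /ord_le om; rewrite coefZ coefXn.
have -> : (2 * n.-1 - l == 2 * n.-1 - deriv_order m)%N = (deriv_order m == l) by lia.
by case: eqP => [->|_]; rewrite ?mulr1 ?mulr0.
Qed.

End JetsOfOrder.
End SectionsOverJets.

(** * Linear algebra of quadratic polynomials *)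

Section FiniteFamilies.
Context {K : fieldType} {V : lmodType K} {I : finType}.
Variable b : I -> V.

Definition combination (v : V) := exists c : I -> K, v = \sum_i c i *: b i.

Lemma combination0 : combination 0.
Proof. by exists (fun=> 0); rewrite big1 // => i _; rewrite scale0r. Qed.

Lemma combinationD v w : combination v -> combination w -> combination (v + w).
Proof.
move=> [c ->] [d ->]; exists (fun i => c i + d i).
by rewrite -big_split; apply: eq_bigr => i _; rewrite scalerDl.
Qed.

Lemma combinationZ a v : combination v -> combination (a *: v).
Proof.
move=> [c ->]; exists (fun i => a * c i).
by rewrite scaler_sumr; apply: eq_bigr => i _; rewrite scalerA.
Qed.

Lemma combination_sum (J : Type) (r : seq J) (P : pred J) (F : J -> V) :
  (forall j, P j -> combination (F j)) -> combination (\sum_(j <- r | P j) F j).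
Proof. by move=> h; elim/big_ind: _ => //; [exact: combination0 | exact: combinationD]. Qed.

Lemma combination_base i : combination (b i).
Proof.
exists (fun j => (j == i)%:R); rewrite (bigD1 i) //= eqxx scale1r big1 ?addr0 //.
by move=> j /negbTE->; rewrite scale0r.
Qed.

Hypothesis b_free : forall c : I -> K, \sum_i c i *: b i = 0 -> forall i, c i = 0.

Lemma free_family_inj : injective b.
Proof.
move=> i j bij; apply/eqP; apply: contraT => ij.
have := b_free (c := fun k => (k == i)%:R - (k == j)%:R).
rewrite (eq_bigr (fun k => (k == i)%:R *: b k - (k == j)%:R *: b k)); last first.
  by move=> k _; rewrite scalerBl.
have pick k : \sum_l (l == k)%:R *: b l = b k.
  rewrite (bigD1 k) //= eqxx scale1r big1 ?addr0 //.
  by move=> l /negbTE->; rewrite scale0r.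
rewrite sumrB !pick bij subrr => /(_ erefl i) /eqP.
by rewrite eqxx (negbTE ij) subr0 oner_eq0.
Qed.

Lemma span_range : lin_span (range b) = combination.
Proof.
apply/seteqP; split=> v.
  move=> [s [c [hs ->]]]; rewrite big_seq; apply: combination_sum => w /hs[i _ <-].
  by apply: combinationZ; exact: combination_base.
move=> [c ->]; exists [seq b i | i <- enum I].
(* Coefficients in [lin_span] are attached to vectors; the index is recovered by injectivity of
   [b]. *)
exists (fun w => if [pick i | b i == w] is Some i then c i else 0); split.
  by move=> w /mapP[i _ ->]; exists i.
rewrite big_map big_enum /=; apply: eq_bigr => i _.
case: pickP => [j /eqP/free_family_inj -> //|/(_ i)].
by rewrite eqxx.
Qed.

Lemma lin_indep_range : lin_indep (range b).
Proof.
move=> s c us hs h0 w ws; have [i _ iw] := hs w ws.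
pose d i := if b i \in s then c (b i) else 0.
suff : d i = 0 by rewrite /d iw ws.
apply: b_free; rewrite -[RHS]h0.
have -> : \sum_(w <- s) c w *: w = \sum_(w <- [seq b i | i <- enum I & b i \in s]) c w *: w.
  apply: perm_big; apply: uniq_perm => //.
    rewrite map_inj_uniq; last exact: free_family_inj.
    by rewrite filter_uniq // enum_uniq.
  move=> u; apply/idP/mapP => [us'|[j]]; last by rewrite mem_filter => /andP[? _] ->.
  have [j _ ju] := hs u us'; exists j => //.
  by rewrite mem_filter ju us' mem_enum.
rewrite big_map big_filter big_enum_cond /= [RHS]big_mkcond /=.
by apply: eq_bigr => j _; rewrite /d; case: ifP => // _; rewrite scale0r.
Qed.

Lemma range_is_basis : is_basis (range b) combination.
Proof. by split; [exact: lin_indep_range | exact: span_range]. Qed.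

Lemma combination_has_dim : has_dim combination #|I|.
Proof.
exists [seq b i | i <- enum I]; split.
- by rewrite map_inj_uniq ?enum_uniq; last exact: free_family_inj.
- by rewrite size_map -cardE.
have -> : [set` [seq b i | i <- enum I]] = range b.
  apply/seteqP; split=> w /=; first by move=> /mapP[i _ ->]; exists i.
  by move=> [i _ <-]; apply: map_f; rewrite mem_enum.
exact: range_is_basis.
Qed.

End FiniteFamilies.

(** * Quadratic monomials and the span of the proposed basis *)

Section QuadraticPolynomials.
Context {R : realType}.
Local Notation C := R[i].
Variable n : nat.
Hypothesis n_gt0 : (0 < n)%N.
Implicit Types (m : mpoly.multinom n) (p q : jpoly R n) (a b l : nat).

Definition ordn (r : nat) : 'I_n := insubd (Ordinal n_gt0) r.

Lemma val_ordn r : (r < n)%N -> val (ordn r) = r.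
Proof. by move=> rn; rewrite val_insubd rn. Qed.

Definition mon2 a b : mpoly.multinom n :=
  mpoly.mnm_add (mpoly.mnm1 (ordn a)) (mpoly.mnm1 (ordn b)).

Lemma mon2C a b : mon2 a b = mon2 b a.
Proof. by apply/mpoly.mnmP => i; rewrite !mpoly.mnmDE addnC. Qed.

Lemma deriv_orderD m1 m2 :
  deriv_order (mpoly.mnm_add m1 m2) = (deriv_order m1 + deriv_order m2)%N.
Proof.
rewrite /deriv_order -big_split; apply: eq_bigr => i _.
by rewrite mpoly.mnmDE mulnDl.
Qed.

Lemma deriv_order1 (i : 'I_n) : deriv_order (mpoly.mnm1 i) = i.
Proof.
rewrite /deriv_order (bigD1 i) //= mpoly.mnm1E eqxx mul1n big1 ?addn0 // => j ji.
by rewrite mpoly.mnm1E eq_sym (negbTE ji).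
Qed.

Lemma deriv_order_mon2 a b : (a < n)%N -> (b < n)%N -> deriv_order (mon2 a b) = (a + b)%N.
Proof. by move=> an bn; rewrite deriv_orderD !deriv_order1 !val_ordn. Qed.

Lemma fact_mon2 a b : (a < n)%N -> (b < n)%N -> fact_mon (mon2 a b) = (a`! * b`!)%N.
Proof.
have h (i : 'I_n) : (\prod_(r < n) r`! ^ (mpoly.mnm1 i : mpoly.multinom n) r = i`!)%N.
  rewrite (bigD1 i) //= mpoly.mnm1E eqxx expn1 big1 ?muln1 // => j ji.
  by rewrite mpoly.mnm1E eq_sym (negbTE ji).
move=> an bn; rewrite /fact_mon -[in RHS](val_ordn an) -[in RHS](val_ordn bn) -!h.
by rewrite -big_split; apply: eq_bigr => i _; rewrite mpoly.mnmDE expnD.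
Qed.

(** The weight gives a + b = c + d, and the exponent of x^(a) shows that a is c or d; the ordering
    settles the latter case. *)
Lemma mon2_inj a b c d : (b <= a < n)%N -> (d <= c < n)%N -> mon2 a b = mon2 c d ->
  a = c /\ b = d.
Proof.
move=> /andP[ba an] /andP[dc cn] E.
have bn : (b < n)%N := leq_ltn_trans ba an.
have dn : (d < n)%N := leq_ltn_trans dc cn.
have := congr1 (fun m => deriv_order m) E; rewrite !deriv_order_mon2 // => sE.
have := congr1 (fun m => m (ordn a)) E; rewrite /mon2 !mpoly.mnmDE !mpoly.mnm1E eqxx.
rewrite -!(inj_eq val_inj) !val_ordn //.
by case: (c =P a) => ?; case: (d =P a) => ?; rewrite //=; lia.
Qed.

Lemma mon2P m : mpoly.mdeg m = 2%N -> exists a b, (b <= a < n)%N /\ m = mon2 a b.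
Proof.
have o (i : 'I_n) : i = ordn i by apply: val_inj; rewrite val_ordn.
move=> m2; have /eqP : m != mpoly.mnm0 by rewrite -mpoly.mdeg_eq0 m2.
move=> m0; have [i mi] : exists i, m i != 0%N.
  apply: contrapT => h; apply: m0; apply/mpoly.mnmP => i; rewrite mpoly.mnm0E.
  by apply/eqP; apply: contrapT => /negP hi; apply: h; exists i.
have mE : mpoly.mnm_add (mpoly.mnm_sub m (mpoly.mnm1 i)) (mpoly.mnm1 i) = m.
  by apply: mpoly.submK; rewrite mpoly.lep1mP.
have := m2; rewrite -[in LHS]mE mpoly.mdegD mpoly.mdeg1 addn1 => -[] /eqP.
move=> /mpoly.mdeg1P[j /eqP mj]; rewrite mj in mE.
have [ij|/ltnW ij] := leqP i j.
  by exists j, i; rewrite ij ltn_ord -mE /mon2 -!o.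
by exists i, j; rewrite ij ltn_ord -mE mon2C /mon2 -!o.
Qed.

Lemma xder_mul a b : (a < n)%N -> (b < n)%N ->
  xder R n a * xder R n b = mpoly.mpolyX C (mon2 a b).
Proof.
have h r : (r < n)%N -> xder R n r = mpoly.mpolyX C (mpoly.mnm1 (ordn r)).
  move=> rn; rewrite /xder insubT /=; congr (mpoly.mpolyX _ (mpoly.mnm1 _)).
  by apply: val_inj; rewrite val_ordn.
by move=> an bn; rewrite !h // -mpoly.mpolyXD.
Qed.

Definition homog2 p := forall m, mpoly.mcoeff m p != 0 -> mpoly.mdeg m = 2%N.

Lemma homog2P p : p \is mpoly.ishomog1 2 (@mpoly.mdeg n) <-> homog2 p.
Proof.
split=> [/mpoly.dhomogP h m|h].
  by rewrite -mpoly.mcoeff_msupp; exact: h.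
by apply/mpoly.dhomogP => m; rewrite mpoly.mcoeff_msupp; exact: h.
Qed.

Definition index2 := {x : 'I_n * 'I_n | (x.2 < x.1)%N}.

Lemma card_index2 : #|{: index2}| = 'C(n, 2).
Proof.
rewrite card_sig -bin2_sum -sum1_card.
rewrite (eq_bigl (fun x : 'I_n * 'I_n => xpredT x.1 && (x.2 < x.1)%N)) //.
rewrite -(pair_big_dep xpredT (fun i j : 'I_n => (j < i)%N) (fun _ _ => 1%N)) /=.
rewrite big_mkord; apply: eq_bigr => i _.
by rewrite (big_ord_narrow (F := fun=> 1%N) (ltnW (ltn_ord i))) sum1_card card_ord.
Qed.

(* The two families of the basis are indexed together by pairs j < i < n, with
   (i, j) = (r1 + 1, r2) when i + j < n and (i, j) = (k1, k2 + 1) otherwise, so that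
   x^(i-1) x^(j) occurs in each element. *)
Definition quad_elt (x : index2) : jpoly R n :=
  let i := (val x).1 in let j := (val x).2 in
  if (i + j < n)%N then xder R n (i - 1) * xder R n j
  else xder R n i * xder R n (j - 1) -
    (i%:R / (j - 1 + 1)%:R) *: (xder R n (i - 1) * xder R n (j - 1 + 1)).

Lemma basis_n2E : basis_n2 R n = range quad_elt.
Proof.
apply/seteqP; split=> p.
  case=> -[a [b [h1 h2]]].
    move=> ->; have an : (a.+1 < n)%N by lia.
    have bn : (b < n)%N by lia.
    have ba : (Ordinal bn < Ordinal an)%N by [].
    exists (exist _ (Ordinal an, Ordinal bn) ba) => //.
    rewrite /quad_elt /= (_ : (a.+1 + b < n)%N); last by lia.
    by rewrite subn1.
  move=> h3 ->; have an : (a < n)%N by lia.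
  have bn : (b.+1 < n)%N by lia.
  have ba : (Ordinal bn < Ordinal an)%N by rewrite /=; lia.
  exists (exist _ (Ordinal an, Ordinal bn) ba) => //.
  rewrite /quad_elt /= (_ : (a + b.+1 < n)%N = false); last by lia.
  by rewrite !subn1 /= !addn1.
case=> -[[i j] /= ji] _ <-; rewrite /quad_elt /=.
have := ltn_ord i; have := ltn_ord j => jn i_n.
case: ltnP => h.
  by left; exists (i - 1)%N, j; split => //; lia.
right; exists i, (j - 1)%N; split => //; lia.
Qed.

Lemma mcoeff_quad_elt (x : index2) m :
  let i := (val x).1 in let j := (val x).2 in
  mpoly.mcoeff m (quad_elt x) =
  if (i + j < n)%N then (mon2 (i - 1) j == m)%:R
  else (mon2 i (j - 1) == m)%:R - (i%:R / j%:R) * (mon2 (i - 1) j == m)%:R.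
Proof.
case: x => -[i j] /= ji; have := ltn_ord i; have := ltn_ord j => jn i_n.
rewrite /quad_elt /=; case: ltnP => h.
  by rewrite xder_mul ?mpoly.mcoeffX //; lia.
rewrite (_ : (j - 1 + 1)%N = j); last by lia.
by rewrite !xder_mul ?mpoly.mcoeffB ?mpoly.mcoeffZ ?mpoly.mcoeffX //; lia.
Qed.

(** Common to both kinds of basis elements, as (i - 1) + j = i + (j - 1). *)
Definition index2_weight (x : index2) : nat := ((val x).1 + (val x).2 - 1)%N.

Lemma quad_elt_supp x m : mpoly.mcoeff m (quad_elt x) != 0 ->
  mpoly.mdeg m = 2%N /\ deriv_order m = index2_weight x.
Proof.
rewrite mcoeff_quad_elt /index2_weight; case: x => -[i j] /= ji.
have := ltn_ord i; have := ltn_ord j => jn i_n.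
have deg a b : mpoly.mdeg (mon2 a b) = 2%N by rewrite mpoly.mdegD !mpoly.mdeg1.
have ord1 : deriv_order (mon2 (i - 1) j) = (i + j - 1)%N by rewrite deriv_order_mon2; lia.
case: ltnP => h.
  by case: (mon2 (i - 1) j =P m) => [<- _|_]; rewrite ?eqxx.
have ord2 : deriv_order (mon2 i (j - 1)) = (i + j - 1)%N by rewrite deriv_order_mon2; lia.
case: (mon2 i (j - 1) =P m) => [<- _ //|_].
case: (mon2 (i - 1) j =P m) => [<- _ //|_].
by rewrite mulr0 subr0 eqxx.
Qed.

(* The coefficient of x^(i-1) x^(j) only sees the elements of index (i, j) and
   (i-1, j+1), hence a triangular system. *)
Lemma quad_elt_free (c : index2 -> C) : \sum_x c x *: quad_elt x = 0 -> forall x, c x = 0.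
Proof.
move=> h0 x; have [k] := ubnP (val x).1; elim: k x => // k IH x xk.
have E := congr1 (mpoly.mcoeff (mon2 ((val x).1 - 1) (val x).2)) h0.
move: E; rewrite mpoly.mcoeff0 raddf_sum (bigD1 x) //= big1 ?addr0; last first.
  move=> y yx; rewrite mpoly.mcoeffZ.
  have [yi|iy] := ltnP (val y).1 (val x).1.
    by rewrite IH ?mul0r // (leq_trans yi).
  rewrite mcoeff_quad_elt.
  case: x y {xk h0 IH} yx iy => -[i j] /= ji -[[i' j'] /= ji'] yx iy.
  have := ltn_ord i; have := ltn_ord j; have := ltn_ord i'; have := ltn_ord j'.
  move=> j'n i'n jn i_n.
  have e1 : (mon2 (i' - 1) j' == mon2 (i - 1) j) = false.
    apply/eqP => /mon2_inj []; [lia|lia|] => ii jj.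
    move/eqP: yx; apply; apply: val_inj => /=.
    by congr (_, _); apply: val_inj => /=; lia.
  (* Equality would force i' = i - 1, against [iy]: those elements are already removed by
     induction. *)
  have e2 : (i' + j' < n)%N = false -> (mon2 i' (j' - 1) == mon2 (i - 1) j) = false.
    by move=> hn; apply/eqP => /mon2_inj []; lia.
  rewrite e1; case: ltnP => hn; first by rewrite mulr0.
  by rewrite e2 ?mulr0 ?subr0 ?mulr0 //; lia.
rewrite mpoly.mcoeffZ mcoeff_quad_elt eqxx.
case: x {xk} => -[i j] /= ji; have := ltn_ord i; have := ltn_ord j => jn i_n.
case: ltnP => hn; first by rewrite mulr1.
have -> : (mon2 i (j - 1) == mon2 (i - 1) j) = false.
  by apply/eqP => /mon2_inj []; lia.
(* The diagonal coefficient is - i / j, with j > 0 because i + j >= n > i. *)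
rewrite sub0r mulr1 => /eqP; rewrite mulf_eq0 oppr_eq0 mulf_eq0 invr_eq0 !pnatr_eq0.
have -> : (i == 0%N :> nat) = false by lia.
have -> : (j == 0%N :> nat) = false by lia.
by rewrite !orbF => /eqP.
Qed.

Lemma combination_low a b : (b <= a)%N -> (a + b + 2 <= n)%N ->
  combination quad_elt (mpoly.mpolyX C (mon2 a b)).
Proof.
move=> ba abn; rewrite -xder_mul; [|lia|lia].
have : basis_n2 R n (xder R n a * xder R n b) by left; exists a, b.
by rewrite basis_n2E => -[x _ <-]; exact: combination_base.
Qed.

(** The product y_a y_b of Taylor coefficients. *)
Definition nmon a b : jpoly R n := (a`!%:R * b`!%:R)^-1 *: mpoly.mpolyX C (mon2 a b).

(* Modulo the basis elements all the normalized monomials of a weight l >= n-1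
   coincide with the middle one. *)
Lemma combination_high a b : (b <= a < n)%N -> (n <= (a + b).+1)%N ->
  combination quad_elt (nmon a b - nmon (uphalf (a + b)) (a + b)./2).
Proof.
move=> /andP[]; have [k] := ubnP (a - b); elim: k a b => // k IH a b abk ba an hab.
have [ab|ab] := leqP a b.+1.
  have -> : uphalf (a + b) = a by lia.
  have -> : (a + b)./2 = b by lia.
  by rewrite subrr; exact: combination0.
have -> : nmon a b - nmon (uphalf (a + b)) (a + b)./2 =
   (nmon a b - nmon (a - 1) b.+1) +
   (nmon (a - 1) b.+1 - nmon (uphalf (a - 1 + b.+1)) (a - 1 + b.+1)./2).
  by rewrite addrA subrK (_ : (a - 1 + b.+1)%N = (a + b)%N); last lia.
apply: combinationD; last by apply: IH; lia.
have : basis_n2 R n (xder R n a * xder R n b -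
    (a%:R / (b + 1)%:R) *: (xder R n (a - 1) * xder R n (b + 1))).
  by right; exists a, b; split => //; lia.
rewrite basis_n2E => -[x _]; rewrite addn1 !xder_mul; [|lia..].
move=> xE.
suff -> : nmon a b - nmon (a - 1) b.+1 = (a`!%:R * b`!%:R)^-1 *: quad_elt x.
  by apply: combinationZ; exact: combination_base.
rewrite xE scalerBr scalerA /nmon; congr (_ - _ *: _).
case: a {IH abk ba an hab xE} ab => [//|a _].
rewrite subn1 /= !factS !natrM.
have f0 r : r`!%:R != 0 :> C by rewrite pnatr_eq0 -lt0n fact_gt0.
have s0 r : r.+1%:R != 0 :> C by rewrite pnatr_eq0.
have := (f0 a, f0 b, s0 a, s0 b).
set fa := a`!%:R; set fb := b`!%:R; set sa := a.+1%:R; set sb := b.+1%:R.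
by move=> [[[? ?] ?] ?]; field; do ?[apply/andP; split].
Qed.

(** In each weight l >= n - 1 the middle product [T l] times the vanishing weight sum is subtracted,
    which leaves differences covered by [combination_high]. In lower weights every monomial is
    itself a basis element, so [T l] is 0 there. *)
Lemma combination_of_weight_sums p : homog2 p ->
  (forall l, (n <= l.+1)%N -> \sum_(m <- mpoly.msupp p | deriv_order m == l)
    mpoly.mcoeff m p * (fact_mon m)%:R = 0) ->
  combination quad_elt p.
Proof.
move=> hp hS.
pose T l : jpoly R n := if (n <= l.+1)%N then nmon (uphalf l) l./2 else 0.
pose w m : C := mpoly.mcoeff m p * (fact_mon m)%:R.
have ordN m : m \in mpoly.msupp p -> (deriv_order m < 2 * n)%N.
  rewrite mpoly.mcoeff_msupp => /hp/mon2P[a [b [/andP[ba an] ->]]].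
  by rewrite deriv_order_mon2 //; lia.
have z : \sum_(m <- mpoly.msupp p) w m *: T (deriv_order m) = 0.
  rewrite big_seq.
  transitivity (\sum_(m <- mpoly.msupp p | m \in mpoly.msupp p)
      \sum_(l < 2 * n) if deriv_order m == l then w m *: T l else 0).
    apply: eq_bigr => m mp; rewrite (bigD1 (Ordinal (ordN m mp))) //= eqxx.
    rewrite big1 ?addr0 // => l; rewrite -val_eqE /= eq_sym.
    by move=> /negbTE ->.
  rewrite -big_seq exchange_big big1 //= => l _.
  rewrite -big_mkcond /= -scaler_suml /T.
  by case: leqP => hl; [rewrite hS ?scale0r | rewrite scaler0].
rewrite -[p]subr0 -z [p in p - _]mpoly.mpolyE -sumrB big_seq.
apply: combination_sum => m; rewrite mpoly.mcoeff_msupp.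
move=> /hp/mon2P[a [b [/andP[ba an] mE]]].
have bn : (b < n)%N := leq_ltn_trans ba an.
rewrite /w -scalerA -scalerBr; apply: combinationZ.
rewrite mE fact_mon2 // deriv_order_mon2 // /T.
case: leqP => hab; last first.
  by rewrite scaler0 subr0; apply: combination_low => //; lia.
have f0 : a`!%:R * b`!%:R != 0 :> C.
  by rewrite mulf_neq0 // pnatr_eq0 -lt0n fact_gt0.
have -> : mpoly.mpolyX C (mon2 a b) = (a`! * b`!)%:R *: nmon a b.
  by rewrite /nmon scalerA natrM mulfV // scale1r.
by rewrite -scalerBr; apply: combinationZ; apply: combination_high; rewrite ?ba.
Qed.

Lemma regular_quad_elt x : regular (quad_elt x).
Proof.
rewrite /quad_elt; case: x => -[i j] /= ji.
have := ltn_ord i; have := ltn_ord j => jn i_n.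
case: ltnP => h; first by apply: regular_low => //; lia.
by apply: regular_high => //; lia.
Qed.

Lemma combination_regular p : combination quad_elt p -> regular p.
Proof.
move=> [c ->]; elim/big_ind: _ => [|q r|x _]; first exact: regular0.
  exact: regularD.
by apply: regularZ; exact: regular_quad_elt.
Qed.

Lemma combination_homog2 p : combination quad_elt p -> homog2 p.
Proof.
move=> [c ->] m; rewrite raddf_sum /=; apply: contraNeq => hm.
rewrite big1 // => x _; rewrite mpoly.mcoeffZ.
have [->|h] := eqVneq (mpoly.mcoeff m (quad_elt x)) 0; first by rewrite mulr0.
by have [/eqP] := quad_elt_supp h; rewrite (negbTE hm).
Qed.

End QuadraticPolynomials.

Theorem theorem1p1 (R : realType) (t0 : R) (n : nat) (hn : (2 <= n)%N)
    (Sinf : chart -> P1 R -> R[i]) (hSinf : hol_section_P1 n Sinf)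
    (hzero : forall p : P1 R, section_zero Sinf p <-> p = None) :
  [/\ is_basis (basis_n2 R n) (Pnd n t0 Sinf 2),
      is_direct_sum (Pnd n t0 Sinf 2)
        (fun l : 'I_(2 * n - 4).+1 => Pndl n t0 Sinf 2 l) &
      has_dim (Pnd n t0 Sinf 2) 'C(n, 2)].
Proof.
have n_gt0 : (0 < n)%N by lia.
have [c c0 Sc] := section_constant hSinf hzero.
have free := @quad_elt_free R n n_gt0.
have PndE : Pnd n t0 Sinf 2 = combination (@quad_elt R n).
  apply/seteqP; split=> p.
    move=> [/homog2P hp Pp]; apply: (combination_of_weight_sums n_gt0 hp).
    apply: (Pn_weight_sums n_gt0 c0 Sc Pp) => m.
    by rewrite mpoly.mcoeff_msupp; exact: hp.
  move=> cp; split.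
    by apply/homog2P; exact: (combination_homog2 n_gt0 cp).
  exact: (regular_Pn t0 n_gt0 c0 Sc (combination_regular n_gt0 cp)).
split.
- by rewrite (basis_n2E n_gt0) PndE; exact: (range_is_basis free).
(* The polynomials that span [Pndl] already form a subspace, so the span adds nothing. *)
- have PndlE (l : nat) p : Pndl n t0 Sinf 2 l p <->
      Pnd n t0 Sinf 2 p /\ forall m, mpoly.mcoeff m p != 0 -> deriv_order m = l.
    split=> [[s [d [hs ->]]]|[Pp hp]]; last first.
      exists [:: p], (fun=> 1); split; last by rewrite big_seq1 scale1r.
      move=> w; rewrite inE => /eqP ->; split => // m.
      by rewrite mpoly.mcoeff_msupp; exact: hp.
    split.
      rewrite PndE big_seq; apply: combination_sum => w /hs[Pw _].
      by apply: combinationZ; rewrite PndE in Pw.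
    move=> m; rewrite raddf_sum big_seq => /=; apply: contraNeq => ml.
    rewrite big1 // => w /hs[_ hw]; rewrite mpoly.mcoeffZ.
    have [->|wm] := eqVneq (mpoly.mcoeff m w) 0; first by rewrite mulr0.
    by move: ml; rewrite hw ?eqxx // mpoly.mcoeff_msupp.
  split.
    apply/seteqP; split=> p.
      rewrite PndE => -[d ->].
      (* i <= n - 1 and j <= n - 2 give i + j - 1 <= 2 n - 4. *)
      have wt (x : index2 n) : (index2_weight x < (2 * n - 4).+1)%N.
        case: x => -[i j] /= ji; have := ltn_ord i; have := ltn_ord j.
        by rewrite /index2_weight /=; lia.
      exists (fun l => \sum_(x | Ordinal (wt x) == l) d x *: quad_elt x).
        move=> l; apply/PndlE; split.
          rewrite PndE; apply: combination_sum => x _.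
          by apply: combinationZ; exact: combination_base.
        move=> m; rewrite raddf_sum /=; apply: contraNeq => ml.
        rewrite big1 // => x /eqP xl; rewrite mpoly.mcoeffZ.
        have [->|xm] := eqVneq (mpoly.mcoeff m (@quad_elt R n x)) 0; first by rewrite mulr0.
        by move: ml; rewrite -xl; have [_ ->] := quad_elt_supp n_gt0 xm; rewrite eqxx.
      by rewrite (partition_big (fun x => Ordinal (wt x)) xpredT).
    move=> [u hu ->]; rewrite PndE.
    have hc l : combination (@quad_elt R n) (u l) by have /PndlE[] := hu l; rewrite PndE.
    by have := @combination_sum _ _ _ (@quad_elt R n) _ (index_enum _) xpredT u (fun l _ => hc l).
  move=> u hu hsum l; apply/mpoly.mpolyP => m; rewrite mpoly.mcoeff0.
  have hl k : mpoly.mcoeff m (u k) != 0 -> deriv_order m = k.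
    by have /PndlE[_] := hu k; exact.
  apply/eqP; apply: contraT => ml.
  have := congr1 (mpoly.mcoeff m) hsum; rewrite mpoly.mcoeff0 raddf_sum (bigD1 l) //=.
  rewrite big1 ?addr0 => [|k kl]; first by move=> /eqP; rewrite (negbTE ml).
  apply/eqP; apply: contraNT kl => mk; apply/eqP/val_inj.
  by rewrite /= -(hl k mk) -(hl l ml).
- by rewrite PndE -card_index2; exact: (combination_has_dim free).
Qed.
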